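(* Let $\mathcal{A}:\mathbb{S}^n\to\mathbb{R}^m$ be a fixed linear mapping and consider the standard linear SDP problem $\min\{\langle C,X\rangle:\mathcal{A}(X)=b,\ X\in\mathbb{S}^n_+\}$. For a generic $b\in\mathbb{R}^m$ and $C\in\mathbb{S}^n$, the primal and dual constraint nondegeneracy hold everywhere (primal constraint nondegeneracy at every primal feasible point, dual constraint nondegeneracy at every dual feasible point). As a result, the quadratic growth condition holds at the optimal solution.
   Context: $\mathbb{S}^n$: real symmetric $n\times n$ matrices with $\langle A,B\rangle=\mathrm{Tr}(AB^\top)$ and Frobenius norm $\|\cdot\|$; $\mathbb{S}^n_+$: positive semidefinite cone. ''Generic'' means for all $(b,C)\in\mathbb{R}^m\times\mathbb{S}^n$ except for a set of measure $0$. The dual problem is $\max\{b^\top y:\ C-\mathcal{A}^*(y)\in\mathbb{S}^n_+,\ y\in\mathbb{R}^m\}$. For $Z\in\mathbb{S}^n_+$ let $\mathrm{lin}(T_Z)=\{H\in\mathbb{S}^n:V^\top HV=0\}$, where the columns of $V$ form a basis of $\ker Z$ (the lineality space of the tangent cone of $\mathbb{S}^n_+$ at $Z$). Primal constraint nondegeneracy at a primal feasible $X$: $\mathcal{A}(\mathrm{lin}(T_X))=\mathbb{R}^m$. Dual constraint nondegeneracy at a dual feasible $y$, with $Z=C-\mathcal{A}^*(y)$: $\mathcal{A}^*(\mathbb{R}^m)+\mathrm{lin}(T_Z)=\mathbb{S}^n$. Quadratic growth condition at the optimal solution: let $X^*$ be the optimal solution, $r=\mathrm{rank}(X^* )$,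 and $X^*=R^*R^{*\top}$ with $R^*\in\mathbb{R}^{n\times r}$ (so $\mathrm{rank}(R^* )=r$). Then $R^*$ is a $(0,0)$-stationary point of the factorized problem $\min\{\langle C,RR^\top\rangle:\mathcal{A}(RR^\top)=b,\ R\in\mathbb{R}^{n\times r}\}$, meaning that there is $\lambda\in\mathbb{R}^m$ with $(C-\mathcal{A}^*(\lambda))R^*=0$ and $C-\mathcal{A}^*(\lambda)\in\mathbb{S}^n_+$; and there exist $\alpha,\epsilon>0$ such that $\langle C,RR^\top\rangle\ge\langle C,X^*\rangle+\frac{\alpha}{2}\|RR^\top-X^*\|^2$ for every $R\in\mathbb{R}^{n\times r}$ with $\mathcal{A}(RR^\top)=b$ and $\|R-R^*\|<\epsilon$. The assertion applies whenever the primal problem has an optimal solution. *)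

(* Defs.v *)
From HB Require Import structures.
From mathcomp Require Import all_boot all_order all_algebra.
From mathcomp Require Import boolp classical_sets functions reals ereal topology
  normedtype sequences.

Set Implicit Arguments.
Unset Strict Implicit.
Unset Printing Implicit Defensive.

Import Order.TTheory GRing.Theory Num.Theory.

Local Open Scope classical_set_scope.
Local Open Scope ring_scope.

Section SymmetricMatrices.
Variables (R : comNzRingType) (n : nat).

Definition sym_pred : {pred 'M[R]_n} := fun M => M^T == M.

Fact sym_submod_closed : submod_closed sym_pred.
Proof.
split=> [|a u v]; rewrite !unfold_in ?trmx0 // => /eqP uE /eqP vE.
by rewrite linearP /= uE vE.
Qed.

HB.instance Definition _ :=
  GRing.isSubmodClosed.Build R 'M[R]_n sym_pred sym_submod_closed.

Record sym_mx : predArgType :=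
  SymMx { mx_of_sym :> 'M[R]_n; sym_mxP : mx_of_sym \in sym_pred }.

HB.instance Definition _ := [isSub for mx_of_sym].
HB.instance Definition _ := [Choice of sym_mx by <:].
HB.instance Definition _ := [SubChoice_isSubLmodule of sym_mx by <:].

Fact symmetrize_subproof (M : 'M[R]_n) : M + M^T \in sym_pred.
Proof. by rewrite unfold_in linearD /= trmxK addrC. Qed.

Definition add_tr (M : 'M[R]_n) : sym_mx := SymMx (symmetrize_subproof M).

Fact gram_subproof r (L : 'M[R]_(n, r)) : L *m L^T \in sym_pred.
Proof. by rewrite unfold_in trmx_mul trmxK. Qed.

Definition gram r (L : 'M[R]_(n, r)) : sym_mx := SymMx (gram_subproof L).

End SymmetricMatrices.

Notation "''S[' R ]_ n" := (sym_mx R n)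
  (at level 0, n at level 2, format "''S[' R ]_ n") : type_scope.

Section Frobenius.
Variable R : realType.

Definition mxdot p q (A B : 'M[R]_(p, q)) : R := \tr (A *m B^T).

Definition fnorm p q (A : 'M[R]_(p, q)) : R := Num.sqrt (mxdot A A).

Definition psd n (X : 'S[R]_n) : Prop :=
  forall v : 'cV[R]_n, 0 <= (v^T *m X *m v) 0 0.

Lemma mxdotE p q (A B : 'M[R]_(p, q)) :
  mxdot A B = \sum_i \sum_j A i j * B i j.
Proof.
apply: eq_bigr => i _; rewrite mxE; apply: eq_bigr => j _.
by rewrite mxE.
Qed.

End Frobenius.

Section Adjoint.
Variables (R : realType) (n m : nat) (A : {linear 'S[R]_n -> 'cV[R]_m}).

(* The (i, j) entry of A^*(y) is <y, A((E_ij + E_ji) / 2)>; adjointP is the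
   defining property. *)
Definition adjoint_mx (y : 'cV[R]_m) : 'M[R]_n :=
  \matrix_(i, j) (2^-1 * mxdot y (A (add_tr (delta_mx i j)))).

Fact adjoint_subproof y : adjoint_mx y \in @sym_pred R n.
Proof.
rewrite unfold_in; apply/eqP/matrixP => i j; rewrite !mxE.
congr (_ * mxdot _ (A _)); apply: val_inj => /=.
by rewrite !trmx_delta addrC.
Qed.

Definition adjoint (y : 'cV[R]_m) : 'S[R]_n := SymMx (adjoint_subproof y).

Lemma adjointP (y : 'cV[R]_m) (X : 'S[R]_n) :
  mxdot (adjoint y) X = mxdot y (A X).
Proof.
pose f := fun B : 'cV[R]_m => mxdot y B.
have fD : forall u v, f (u + v) = f u + f v.
  by move=> u v; rewrite /f /mxdot linearD /= mulmxDr linearD.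
have fZ : forall a u, f (a *: u) = a * f u.
  by move=> a u; rewrite /f /mxdot linearZ /= -scalemxAr linearZ.
have f0 : f 0 = 0 by rewrite -(scale0r 0) fZ mul0r.
have fs (I : finType) (F : I -> 'cV[R]_m) : f (\sum_i F i) = \sum_i f (F i).
  by apply: (big_morph f fD f0).
have XT : (X : 'M[R]_n)^T = X by apply/eqP; exact: (valP X).
have vs (I : finType) (F : I -> 'S[R]_n) :
    \sum_i F i = \sum_i (F i : 'M[R]_n) :> 'M[R]_n.
  by apply: (big_morph (@mx_of_sym R n)).
have XE : X = \sum_i \sum_j (X i j * 2^-1) *: add_tr (delta_mx i j) :> 'S[R]_n.
  apply: val_inj; rewrite /= vs.
  apply/matrixP => k l; rewrite summxE.
  under eq_bigr => i _.
    rewrite vs summxE.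
    under eq_bigr => j _ do rewrite !mxE mulrDr.
    rewrite big_split /=; over.
  rewrite big_split /= (bigD1 k) //= (bigD1 l) //= !eqxx mulr1.
  rewrite big1 => [|j /negPf jl]; last by rewrite [l == j]eq_sym jl andbF mulr0.
  rewrite [X in _ + X + _]big1 => [|i /negPf ik]; last first.
    by apply: big1 => j _; rewrite [k == i]eq_sym ik mulr0.
  rewrite [X in _ + X](bigD1 l) //= [X in _ + (X + _)](bigD1 k) //=.
  rewrite !eqxx mulr1.
  rewrite [X in _ + (_ + X + _)]big1 => [|j /negPf jk]; last first.
    by rewrite [k == j]eq_sym jk andbF mulr0.
  rewrite [X in _ + (_ + X)]big1 => [|i /negPf il]; last first.
    by apply: big1 => j _; rewrite [l == i]eq_sym il mulr0.
  by rewrite !addr0 -{3}XT mxE -mulrDl -mulr2n -[X in X / 2]mulr_natr mulfK ?pnatr_eq0.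
rewrite mxdotE -/(f (A X)) {2}XE linear_sum fs; apply: eq_bigr => i _.
rewrite linear_sum fs; apply: eq_bigr => j _.
by rewrite linearZ fZ mxE -/(f _) mulrC mulrA.
Qed.

End Adjoint.

Section SDP.
Variables (R : realType) (n m : nat) (A : {linear 'S[R]_n -> 'cV[R]_m}).

(* [row_base (kermx Z^T)] has as rows a basis of { u | u Z^T = 0 }, i.e. of the
   transposes of the v with Z v = 0. *)
Definition ker_basis (Z : 'M[R]_n) : 'M[R]_(n, \rank (kermx Z^T)) :=
  (row_base (kermx Z^T))^T.

Lemma ker_basis_free (Z : 'M[R]_n) (w : 'cV_(\rank (kermx Z^T))) :
  ker_basis Z *m w = 0 -> w = 0.
Proof.
move=> /(congr1 trmx); rewrite trmx_mul trmxK trmx0 => h.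
apply: trmx_inj; rewrite trmx0; apply: (row_free_inj (row_base_free _)).
by rewrite h mul0mx.
Qed.

Lemma ker_basis_span (Z : 'M[R]_n) (v : 'cV[R]_n) :
  Z *m v = 0 <-> exists w, v = ker_basis Z *m w.
Proof.
split=> [Zv|[w ->]].
  have : (v^T <= row_base (kermx Z^T))%MS.
    by rewrite eq_row_base; apply/sub_kermxP; rewrite -trmx_mul Zv trmx0.
  case/submxP => w vE; exists w^T; apply: trmx_inj.
  by rewrite trmx_mul !trmxK.
apply: trmx_inj; rewrite trmx0 !trmx_mul trmxK -mulmxA.
suff -> : row_base (kermx Z^T) *m Z^T = 0 by rewrite mulmx0.
by apply/sub_kermxP; rewrite eq_row_base.
Qed.

Definition lin_tangent (Z : 'S[R]_n) : set 'S[R]_n :=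
  [set H : 'S[R]_n | (ker_basis Z)^T *m H *m ker_basis Z = 0].

Definition primal_feasible (b : 'cV[R]_m) (X : 'S[R]_n) : Prop :=
  A X = b /\ psd X.

Definition primal_optimal (b : 'cV[R]_m) (C X : 'S[R]_n) : Prop :=
  primal_feasible b X /\
  forall Y : 'S[R]_n, primal_feasible b Y -> mxdot C X <= mxdot C Y.

Definition dual_feasible (C : 'S[R]_n) (y : 'cV[R]_m) : Prop :=
  psd (C - adjoint A y).

Definition primal_nondegenerate (X : 'S[R]_n) : Prop :=
  A @` lin_tangent X = [set: 'cV[R]_m].

Definition dual_nondegenerate (C : 'S[R]_n) (y : 'cV[R]_m) : Prop :=
  [set adjoint A z + H | z in [set: 'cV[R]_m] & H in lin_tangent (C - adjoint A y)]
  = [set: 'S[R]_n].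

(* (0,0)-stationarity of L for min { <C, L L^T> : A(L L^T) = b } *)
Definition stationary00 (C : 'S[R]_n) r (L : 'M[R]_(n, r)) : Prop :=
  exists lambda : 'cV[R]_m,
    (C - adjoint A lambda : 'S[R]_n) *m L = 0 /\ psd (C - adjoint A lambda).

Definition local_growth (b : 'cV[R]_m) (C X : 'S[R]_n) r (Ls : 'M[R]_(n, r)) :
    Prop :=
  exists alpha eps : R, [/\ 0 < alpha, 0 < eps &
    forall L : 'M[R]_(n, r), A (gram L) = b -> fnorm (L - Ls) < eps ->
      mxdot C X + alpha / 2 * fnorm (gram L - X : 'S[R]_n) ^+ 2
        <= mxdot C (gram L)].

Definition quadratic_growth (b : 'cV[R]_m) (C X : 'S[R]_n) : Prop :=
  forall Ls : 'M[R]_(n, \rank X), X = gram Ls ->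
    stationary00 C Ls /\ local_growth b C X Ls.

End SDP.

Section NullSets.
Variable R : realType.

(* Lebesgue null sets of R^I, I finite: for every e > 0 there is a countable
   cover by closed boxes of total volume at most e. The boxes are indexed by a
   subset P of nat, so that the empty cover is allowed; this matters when I is
   empty, where every box has volume 1. *)
Definition lebesgue_null (I : finType) (N : set (I -> R)) : Prop :=
  forall e : R, 0 < e -> exists (P : pred nat) (lo hi : nat -> I -> R),
    [/\ forall k i, lo k i <= hi k i,
        forall x, N x -> exists2 k, P k & forall i, lo k i <= x i <= hi k i &
        (\sum_(0 <= k <oo | P k) (\prod_i (hi k i - lo k i))%:E <= e%:E)%E].

(* Linear coordinates on R^m x S^n: the entries of b and the entries of C on and
   above the diagonal. Null sets do not depend on the choice of linear
   coordinates. *)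
Definition data_index (m n : nat) : finType :=
  ('I_m + {p : 'I_n * 'I_n | (p.1 <= p.2)%N})%type.

Definition data_coord m n (d : 'cV[R]_m * 'S[R]_n) (i : data_index m n) : R :=
  match i with
  | inl k => d.1 k 0
  | inr p => d.2 (val p).1 (val p).2
  end.

Definition generic m n (P : 'cV[R]_m -> 'S[R]_n -> Prop) : Prop :=
  lebesgue_null
    (@data_coord m n @` [set d : 'cV[R]_m * 'S[R]_n | ~ P d.1 d.2]).

End NullSets.

(* Main.v *)
From HB Require Import structures.
Require Import Defs.
From mathcomp Require Import all_boot all_order all_algebra.
From mathcomp Require Import ring lra.
From mathcomp Require Import boolp classical_sets reals ereal topology
  normedtype sequences.

Set Implicit Arguments.
Unset Strict Implicit.
Unset Printing Implicit Defensive.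

Import Order.TTheory GRing.Theory Num.Theory.

Local Open Scope classical_set_scope.
Local Open Scope ring_scope.

(** Both nondegeneracy conditions are transversality statements, and the usual
    proof of their genericity is Sard's theorem for the maps
    [L |-> A (L L^T)] and [(L, y) |-> L L^T + A^*(y)]. Here the analysis in
    Sard's theorem is replaced by field-theoretic derivations of the real
    numbers.

    Genericity. Let [k] be the countable ring generated by the matrix entries
    of [A]. Up to a Lebesgue null set, the coordinates of [(b, C)] are
    algebraically independent over [k]: the exceptional set is a countable
    union of sets on which a nonzero polynomial in one coordinate, with
    coefficients depending polynomially on the others, vanishes ([root_null]).
    A simple root depends in a Lipschitz way on the coefficients, so such sets
    decompose into countably many bounded Lipschitz graphs, and these have
    arbitrarily cheap covers ([lipschitz_graph_null]). If the coordinates are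
    independent, then for every choice of values [u_i] there is a derivation
    [D] of the whole field of real numbers that kills [k] and has
    [D x_i = u_i] ([generic_derivation]): derivations extend to polynomial
    rings freely, to algebraic extensions in characteristic zero, and to the
    whole field by Zorn's lemma ([extend_derivation]).

    Transversality. Failure of primal nondegeneracy at [X] is witnessed by some
    [y <> 0] with [A^*(y) X = 0]. Then [<y, b> = <A^*(y), X> = 0]; applying [D]
    gives [<y, D b> + <D y, b> = 0], and [<D y, b> = tr (D (A^*(y)) X)]
    vanishes because [A^*(y) X = 0] ([trace_mul_derivation]). So [<y, D b> = 0]
    for every [D], and [D b = y] forces [y = 0]. Dually, a witness [W <> 0]
    with [A W = 0] and [(C - A^*(y)) W = 0] satisfies [<C, W> = 0], hence
    [<D C, W> = 0], and [D C = W] forces [W = 0].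

    Quadratic growth. Primal transversality at the optimal [X] is a constraint
    qualification: it makes [A] map the cone of feasible directions of the
    positive semidefinite cone at [X] onto the whole space
    ([radial_cone_onto]), so second-order errors along tangent directions can
    be corrected and a multiplier exists ([optimal_multiplier]), with slack
    matrix [Z], [Z X = 0]. Dual transversality says that [W |-> (A W, Z W)] is
    injective, hence [|W| <= c |Z W|] on the kernel of [A]. For
    [W = L L^T - X] this gives [|W| <= c |Z L| |L|], while
    [|Z L|^2 <= c' <Z, L L^T>] since [Z] is positive semidefinite, and
    [<Z, L L^T>] is the excess of the objective. *)

(** * Extending derivations of a field *)

Section Derivations.
Variable F : numFieldType.
Implicit Types (G : set (F * F)) (x y u v : F) (p q : {poly F}).

(** A pair [(x, u)] stands for the dual number [x + u eps], [eps^2 = 0]: this is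
    a subring of the dual numbers over [F]. *)
Definition dual_subring G : Prop :=
  [/\ G (1, 0),
      forall x u y v, G (x, u) -> G (y, v) -> G (x - y, u - v) &
      forall x u y v, G (x, u) -> G (y, v) -> G (x * y, x * v + u * y)].

(** A derivation of a subring [S] with values in [F] is the same thing as a
    ring homomorphism [x |-> x + D x eps]; its graph is a subring of the dual
    numbers that meets [F eps] only in zero. Working with graphs makes
    extension of derivations an inclusion of sets, as Zorn's lemma wants. *)
Definition derivation_graph G : Prop :=
  dual_subring G /\ forall u, G (0, u) -> u = 0.

(** [p + q eps] is then a polynomial over the dual subring [G]. *)
Definition lifts G p q : Prop := forall i, G (p`_i, q`_i).

(** The values at [x + u eps] of the polynomials [p + q eps] over [G], that is,
    the subring generated by [G] and [x + u eps]. *)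
Definition adjoin G x u : set (F * F) :=
  [set z | exists p q, lifts G p q /\ z = (p.[x], q.[x] + p^`().[x] * u)].

Definition derivation (D : F -> F) : Prop :=
  (forall x y, D (x + y) = D x + D y) /\
  (forall x y, D (x * y) = x * D y + D x * y).

Section Subring.
Variables (G : set (F * F)) (GR : dual_subring G).

Lemma dual_subring0 : G (0, 0).
Proof. by case: GR => G1 GB _; have := GB _ _ _ _ G1 G1; rewrite !subrr. Qed.

Lemma dual_subringD x u y v : G (x, u) -> G (y, v) -> G (x + y, u + v).
Proof.
case: GR => _ GB _ Gx Gy; have := GB _ _ _ _ dual_subring0 Gy.
by move=> /(GB _ _ _ _ Gx); rewrite !sub0r !opprK.
Qed.

Lemma dual_subring_sum (I : Type) (s : seq I) (f g : I -> F) :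
  (forall i, G (f i, g i)) -> G (\sum_(i <- s) f i, \sum_(i <- s) g i).
Proof.
move=> Gfg; elim: s => [|i s IHs]; first by rewrite !big_nil; exact: dual_subring0.
by rewrite !big_cons; apply: dual_subringD.
Qed.

Lemma dual_subring_int (z : int) : G (z%:~R, 0).
Proof.
case: (GR) => G1 GB _.
have Gn k : G (k%:R, 0).
  elim: k => [|k IHk]; first exact: dual_subring0.
  by rewrite -natr1 -(addr0 0); apply: dual_subringD.
case: z => k; rewrite ?NegzE ?mulrNz; first exact: Gn.
by have := GB _ _ _ _ dual_subring0 (Gn k.+1); rewrite subrr sub0r.
Qed.

Lemma liftsC x u : G (x, u) -> lifts G x%:P u%:P.
Proof. by move=> Gx i; rewrite !coefC; case: eqP => // _; exact: dual_subring0. Qed.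

Lemma liftsX : lifts G 'X 0.
Proof.
move=> i; rewrite coef0 coefX; case: eqP => _; last exact: dual_subring0.
by case: GR.
Qed.

Lemma liftsB p q p' q' : lifts G p q -> lifts G p' q' -> lifts G (p - p') (q - q').
Proof. by move=> Gp Gq i; rewrite !coefB; case: GR => _ + _; apply. Qed.

Lemma liftsM p q p' q' : lifts G p q -> lifts G p' q' ->
  lifts G (p * p') (p * q' + q * p').
Proof.
move=> Gp Gq i; rewrite coefD !coefM -big_split /=.
by apply: dual_subring_sum => j; case: GR => _ _; apply.
Qed.

Lemma liftsXn k : lifts G 'X^k 0.
Proof.
elim: k => [|k IHk]; first by rewrite expr0; apply: liftsC; case: GR.
by rewrite exprS; have := liftsM liftsX IHk; rewrite mulr0 mul0r addr0.
Qed.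

Lemma lifts_deriv p q : lifts G p q -> lifts G p^`() q^`().
Proof.
move=> Gp i; rewrite !coef_deriv; have := Gp i.+1; move: p`__ q`__ => x u Gx.
have := dual_subring_int i.+1; rewrite -pmulrn => Gi.
case: GR => _ _ GM; have := GM _ _ _ _ Gi Gx.
by rewrite mul0r addr0 !mulr_natl.
Qed.

Lemma adjoin_subring x u : dual_subring (adjoin G x u).
Proof.
split.
- exists 1, 0; split; first by rewrite -polyC1 -polyC0; apply: liftsC; case: GR.
  by rewrite -polyC1 derivC !hornerE.
- move=> y v y' v' [p [q [Gp [-> ->]]]] [p' [q' [Gp' [-> ->]]]].
  exists (p - p'), (q - q'); split; first exact: liftsB.
  by rewrite derivB !hornerE; congr (_, _); ring.
- move=> y v y' v' [p [q [Gp [-> ->]]]] [p' [q' [Gp' [-> ->]]]].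
  exists (p * p'), (p * q' + q * p'); split; first exact: liftsM.
  by rewrite derivM !hornerE; congr (_, _); ring.
Qed.

Lemma sub_adjoin x u : G `<=` adjoin G x u.
Proof.
move=> [y v] Gy; exists y%:P, v%:P; split; first exact: liftsC.
by rewrite derivC !hornerE.
Qed.

Lemma mem_adjoin x u : adjoin G x u (x, u).
Proof.
exists 'X, 0; split; first exact: liftsX.
by rewrite derivX !hornerE.
Qed.

End Subring.

Lemma adjoin_graph G x u : derivation_graph G ->
    (forall p q, lifts G p q -> p.[x] = 0 -> q.[x] + p^`().[x] * u = 0) ->
  derivation_graph (adjoin G x u).
Proof.
move=> [GR _] Gx; split; first exact: adjoin_subring.
by move=> v [p [q [Gp [p0 ->]]]]; apply: Gx.
Qed.

Lemma lifts0 G q : derivation_graph G -> lifts G 0 q -> q = 0.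
Proof.
move=> [_ G0] Gq; apply/polyP => i; rewrite coef0; apply: G0.
by have := Gq i; rewrite coef0.
Qed.

(** If [x] is transcendental over the domain of the derivation, then its
    derivative can be prescribed at will. *)
Lemma adjoin_transcendental G x u : derivation_graph G ->
    (forall p q, lifts G p q -> p.[x] = 0 -> p = 0) ->
  derivation_graph (adjoin G x u).
Proof.
move=> GG Gx; apply: adjoin_graph => // p q Gp px0.
have p0 := Gx _ _ Gp px0; rewrite p0 in Gp *; rewrite (lifts0 GG Gp).
by rewrite -[0]/(0%:P) derivC !hornerE.
Qed.

(** Take [p] of minimal degree with [p.[x] = 0]. In characteristic zero
    [p^`().[x] <> 0] by minimality, so the equation obtained by differentiating
    [p.[x] = 0] has a unique solution [u]. Every other relation follows from
    this one by pseudo-division by [p], done one leading term at a time. *)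
Lemma adjoin_algebraic G x p q : derivation_graph G ->
    lifts G p q -> p != 0 -> p.[x] = 0 ->
  exists u, derivation_graph (adjoin G x u).
Proof.
move=> GG Gpq pN0 px0; have GR := GG.1.
have [k kP] : exists k, exists p q, [/\ lifts G p q, p != 0, p.[x] = 0 & size p = k].
  by exists (size p), p, q.
have {p q Gpq pN0 px0 kP k} [p [q [Gpq pN0 px0 pmin]]] : exists p q,
    [/\ lifts G p q, p != 0, p.[x] = 0 &
      forall p' q', lifts G p' q' -> p' != 0 -> p'.[x] = 0 -> (size p <= size p')%N].
  have exk : exists k, `[< exists p q, [/\ lifts G p q, p != 0, p.[x] = 0 & size p = k] >].
    by exists k; apply/asboolP.
  case: (ex_minnP exk) => d /asboolP[p' [q' [Gp' p'0 p'x <-]]] dmin.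
  exists p', q'; split=> // p2 q2 Gp2 p20 p2x; apply: dmin; apply/asboolP.
  by exists p2, q2.
have sp : (1 < size p)%N.
  rewrite ltnNge; apply/negP => /size1_polyC pE; move: px0 pN0.
  by rewrite pE hornerC => ->; rewrite polyC0 eqxx.
have sp' : (size p^`() < size p)%N by rewrite lt_size_deriv.
have p'N0 : p^`() != 0.
  case E: (size p) sp => [|[|k]] // _.
  apply/eqP => /(congr1 (fun r : {poly F} => r`_k)).
  rewrite coef_deriv coef0 => /eqP; rewrite mulrn_eq0 /=.
  by rewrite -[k.+1]/(k.+2.-1) -E -/(lead_coef p) lead_coef_eq0 (negPf pN0).
have p'x : p^`().[x] != 0.
  apply/eqP => p'x; have := pmin _ _ (lifts_deriv GR Gpq) p'N0 p'x.
  by rewrite leqNgt sp'.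
pose u := - q.[x] / p^`().[x]; exists u; apply: adjoin_graph => // f g.
have pE : q.[x] + p^`().[x] * u = 0 by rewrite /u; field.
have [d] := ubnP (size f); elim: d => // d IHd in f g *.
rewrite ltnS => sf Gfg fx0; have [f0|fN0] := eqVneq f 0.
  rewrite f0 in Gfg *; rewrite (lifts0 GG Gfg) -polyC0 derivC.
  by rewrite !hornerE.
have spf := pmin _ _ Gfg fN0 fx0.
(* [f2 + g2 eps] cancels the leading term of [f + g eps] against [p + q eps]. *)
pose c := lead_coef p; pose c1 := q`_(size p).-1.
pose e := lead_coef f; pose e1 := g`_(size f).-1.
pose h := e%:P * 'X^(size f - size p).
have [h1 Gh] : exists h1, lifts G h h1.
  eexists; apply: (liftsM GR (liftsC GR _) (liftsXn GR _)).
  exact: (Gfg (size f).-1).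
have Gc : lifts G c%:P c1%:P by apply: liftsC => //; exact: (Gpq (size p).-1).
have Gf2 := liftsB GR (liftsM GR Gc Gfg) (liftsM GR Gh Gpq).
move: Gf2; set f2 := (X in lifts G X _); set g2 := (X in lifts G _ X) => Gf2.
have f2x : f2.[x] = 0 by rewrite /f2 !(hornerD, hornerM, hornerN) fx0 px0; ring.
have sf2 : (size f2 < size f)%N.
  rewrite ltnNge; apply/negP => sff2.
  have f_gt0 : (0 < size f)%N by rewrite size_poly_gt0.
  have sf2' : (size f2 <= size f)%N.
    rewrite (leq_trans (size_polyD _ _)) // size_polyN geq_max.
    rewrite mul_polyC (leq_trans (size_scale_leq _ _)) //=.
    rewrite /h -mulrA mul_polyC (leq_trans (size_scale_leq _ _)) //.
    by rewrite mulrC size_mulXn // subnK.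
  have : lead_coef f2 = 0.
    rewrite /lead_coef (@anti_leq (size f2) (size f)) ?sf2' ?sff2 //.
    rewrite coefB coefCM /h -mulrA coefCM coefXnM.
    rewrite ltnNge; have -> : (size f - size p <= (size f).-1)%N.
      by rewrite -subn1 leq_sub2l // ltnW.
    rewrite /=; have -> : ((size f).-1 - (size f - size p) = (size p).-1)%N.
      rewrite -!subn1 -subnDA addnC subnDA subKn //.
    by rewrite -/(lead_coef f) -/(lead_coef p) -/e -/c; ring.
  move/eqP; rewrite lead_coef_eq0 => /eqP f20.
  by move: sff2; rewrite f20 size_poly0 leqNgt f_gt0.
have := IHd f2 g2 (leq_trans sf2 sf) Gf2 f2x.
rewrite /f2 /g2 !(derivD, derivN, derivM, derivC) !(hornerD, hornerN, hornerM, hornerC).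
rewrite fx0 px0 => E; have cN0 : c != 0 by rewrite lead_coef_eq0.
apply: (mulfI cN0); rewrite mulr0 -[RHS]E.
have -> : q.[x] = - (p^`().[x] * u) by apply/eqP; rewrite -addr_eq0 pE.
by ring.
Qed.

Lemma extend_derivation G : derivation_graph G ->
  exists D, derivation D /\ forall x u, G (x, u) -> D x = u.
Proof.
move=> GG.
(* Keeping [G] apart makes the empty chain harmless. *)
pose P (H : set (F * F)) := derivation_graph (G `|` H).
have [C CP tC | H [PH Hmax]] := @Zorn_bigcup _ P.
  have [->|/set0P[C0 CC0]] := eqVneq C set0.
    by rewrite /P bigcup_set0 setU0.
  have mem z : (G `|` \bigcup_(X in C) X) z -> exists2 X, C X & (G `|` X) z.
    by case=> [Gz|[X CX Xz]]; [exists C0; [|left]|exists X; [|right]].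
  have mem2 z t : (G `|` \bigcup_(X in C) X) z -> (G `|` \bigcup_(X in C) X) t ->
      exists2 X, C X & (G `|` X) z /\ (G `|` X) t.
    move=> /mem[X CX Xz] /mem[Y CY Yt]; case: (tC X Y CX CY) => XY.
      by exists Y => //; split=> //; case: Xz; [left|right; apply: XY].
    by exists X => //; split=> //; case: Yt; [left|right; apply: XY].
  have sub X z : C X -> (G `|` X) z -> (G `|` \bigcup_(X in C) X) z.
    by move=> CX [Gz|Xz]; [left|right; exists X].
  split; last first.
    by move=> u /mem[X /CP[_]]; apply.
  split.
  - by left; case: GG => -[].
  - move=> x u y v xu yv; case: (mem2 _ _ xu yv) => X CX [Xx Xy].
    by apply: (sub _ _ CX); case: (CP _ CX) => -[_ + _] _; apply.
  - move=> x u y v xu yv; case: (mem2 _ _ xu yv) => X CX [Xx Xy].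
    by apply: (sub _ _ CX); case: (CP _ CX) => -[_ _] + _; apply.
set K := G `|` H in PH; have KR : dual_subring K by case: PH.
have Kfull x : exists u, K (x, u).
  have [u Gu] : exists u, derivation_graph (adjoin K x u).
    have [[p [q [Kp pN0 px0]]]|] := pselect (exists p q, [/\ lifts K p q, p != 0 & p.[x] = 0]).
      exact: adjoin_algebraic Kp pN0 px0.
    move=> ntr; exists 0; apply: adjoin_transcendental => // p q Kp px0.
    by have [//|pN0] := eqVneq p 0; case: ntr; exists p, q.
  have KA := @sub_adjoin K KR x u.
  have [KxH|] := pselect (adjoin K x u `<=` H).
    by exists u; right; apply: KxH; exact: mem_adjoin.
  move=> nAH; have /Hmax : H `<` adjoin K x u.
    by split=> // z Hz; apply: KA; right.
  case; rewrite /P; have -> // : G `|` adjoin K x u = adjoin K x u.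
  by apply/setUidr => z Gz; apply: KA; left.
have Kfun x u v : K (x, u) -> K (x, v) -> u = v.
  case: KR PH => _ KB _ [_ K0] Ku Kv; apply/eqP; rewrite -subr_eq0; apply/eqP.
  by apply: K0; rewrite -(subrr x); apply: KB.
have [D DP] := choice Kfull.
exists D; split; last by move=> x u Gx; apply: Kfun (DP x) _; left.
split=> x y; first exact: Kfun (DP _) (dual_subringD KR (DP x) (DP y)).
by case: (KR) => _ _ KM; exact: Kfun (DP _) (KM _ _ _ _ (DP x) (DP y)).
Qed.

End Derivations.

(** * Lebesgue null sets *)

Lemma ler_sum_uniq (R : numDomainType) (T : eqType) (s t : seq T) (f : T -> R) :
    uniq s -> {subset s <= t} -> (forall x, 0 <= f x) ->
  \sum_(x <- s) f x <= \sum_(x <- t) f x.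
Proof.
move=> + + f0; elim: s t => [|x s IHs] t /=.
  by move=> _ _; rewrite big_nil sumr_ge0.
move=> /andP[xs us] st; have xt : x \in t by apply: st; rewrite mem_head.
rewrite big_cons (perm_big _ (perm_to_rem xt)) big_cons lerD2l /=.
apply: IHs => // y ys; have : y \in t by apply: st; rewrite inE ys orbT.
rewrite (perm_mem (perm_to_rem xt)) inE => /orP[/eqP yx|//].
by rewrite -yx ys in xs.
Qed.

Section NullSetTheory.
Variables (R : realType) (I : finType).
Implicit Types (N E : set (I -> R)) (x z : I -> R).

Definition volume (lo hi : I -> R) : R := \prod_i (hi i - lo i).

Lemma volume_ge0 lo hi : (forall i, lo i <= hi i) -> 0 <= volume lo hi.
Proof. by move=> le; apply: prodr_ge0 => i _; rewrite subr_ge0. Qed.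

Lemma nneseries_leP (P : pred nat) (a : nat -> R) (e : R) :
    (forall k, 0 <= a k) ->
  (\sum_(0 <= k <oo | P k) (a k)%:E <= e%:E)%E <->
  forall n, \sum_(0 <= k < n | P k) a k <= e.
Proof.
move=> a0; split=> [ae n|ae].
  rewrite -lee_fin -sumEFin; apply: le_trans ae.
  by apply: nneseries_lim_ge => k _ _; rewrite lee_fin.
apply: lime_le; first by apply: is_cvg_nneseries => k _ _; rewrite lee_fin.
by near=> n; rewrite sumEFin lee_fin.
Unshelve. all: by end_near. Qed.

Lemma lebesgue_null_sub N E : E `<=` N -> lebesgue_null N -> lebesgue_null E.
Proof.
move=> EN nN e /nN[P [lo [hi [le cov vol]]]]; exists P, lo, hi; split=> //.
by move=> x /EN /cov.
Qed.

(** Covers may be indexed by any countable type; bounding all finite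
    subfamilies replaces the infinite sum. *)
Lemma lebesgue_null_cover N :
    (forall e, 0 < e -> exists (T : countType) (P : pred T) (lo hi : T -> I -> R),
      [/\ forall t i, lo t i <= hi t i,
          forall x, N x -> exists2 t, P t & forall i, lo t i <= x i <= hi t i &
          forall s : seq T, uniq s -> \sum_(t <- s | P t) volume (lo t) (hi t) <= e]) ->
  lebesgue_null N.
Proof.
move=> H e /H[T [P [lo [hi [le cov vol]]]]].
pose Q k := oapp P false (pickle_inv k : option T).
pose lo' k := oapp lo (fun=> 0) (pickle_inv k : option T).
pose hi' k := oapp hi (fun=> 0) (pickle_inv k : option T).
have le' k i : lo' k i <= hi' k i by rewrite /lo' /hi'; case: pickle_inv => /=.
exists Q, lo', hi'; split=> //.
  move=> x /cov[t Pt xt]; exists (pickle t); first by rewrite /Q pickleK_inv.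
  by move=> i; rewrite /lo' /hi' pickleK_inv /=; exact: xt.
apply/nneseries_leP => [k|n]; first exact: volume_ge0.
apply: le_trans (vol (pmap pickle_inv (index_iota 0 n)) _); last first.
  by apply: (pmap_uniq (g := pickle)); [exact: pickle_invK|exact: iota_uniq].
rewrite [leRHS]big_mkcond big_pmap [leLHS]big_mkcond; apply: ler_sum => k _.
by rewrite /Q /lo' /hi'; case: (pickle_inv _) => [t|] /=; rewrite ?lexx.
Qed.

Lemma lebesgue_null0 : lebesgue_null (set0 : set (I -> R)).
Proof.
apply: lebesgue_null_cover => e e0.
exists unit, pred0, (fun _ _ => 0), (fun _ _ => 0); split=> // s _.
by rewrite big_pred0 // ltW.
Qed.

Lemma lebesgue_null_bigcup (T : countType) (N : T -> set (I -> R)) :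
  (forall t, lebesgue_null (N t)) -> lebesgue_null (\bigcup_t N t).
Proof.
move=> nN; apply: lebesgue_null_cover => e e0.
have e2 k : 0 < e / 2 ^+ k.+1 by rewrite divr_gt0 // exprn_gt0.
have /choice[c cP] t := nN t _ (e2 (pickle t)).
have /choice[c1 c1P] := cP; have /choice[c2 c2P] := c1P.
exists (T * nat)%type, (fun u => c u.1 u.2), (fun u => c1 u.1 u.2),
  (fun u => c2 u.1 u.2).
have le t k i : c1 t k i <= c2 t k i by case: (c2P t) => + _ _; apply.
split=> [[t k] i|x [t _ Nx]|s us]; first exact: le.
  by case: (c2P t) => _ /(_ x Nx)[k Pk xk] _; exists (t, k).
pose f (u : T * nat) := if c u.1 u.2 then volume (c1 u.1 u.2) (c2 u.1 u.2) else 0.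
have f0 u : 0 <= f u by rewrite /f; case: ifP => // _; exact: volume_ge0.
rewrite big_mkcond /=.
pose s1 := undup [seq u.1 | u <- s].
pose K := \max_(u <- s) u.2.+1.
apply: le_trans (_ : \sum_(u <- [seq (t, k) | t <- s1, k <- index_iota 0 K]) f u <= _).
  apply: ler_sum_uniq => // -[t k] tks; apply/allpairsP; exists (t, k).
  split=> //=; first by rewrite mem_undup; apply/mapP; exists (t, k).
  rewrite mem_index_iota /= /K.
  by rewrite (big_rem _ tks) /= leq_max ltnS leqnn.
rewrite big_allpairs.
apply: le_trans (_ : \sum_(t <- s1) e / 2 ^+ (pickle t).+1 <= _).
  apply: ler_sum => t _; case: (c2P t) => _ _ /nneseries_leP ae.
  by rewrite /f /= -big_mkcond /=; apply: ae => k; exact: volume_ge0.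
rewrite -[X in X <= _](big_map pickle xpredT (fun k => e / 2 ^+ k.+1)).
pose L := \max_(k <- [seq pickle t | t <- s1]) k.+1.
apply: le_trans (_ : \sum_(0 <= k < L) e / 2 ^+ k.+1 <= _).
  apply: ler_sum_uniq => [||k]; last exact/ltW/e2.
    by rewrite map_inj_uniq ?undup_uniq //; exact: (pcan_inj pickleK_inv).
  move=> k ks; rewrite mem_index_iota /= /L.
  by rewrite (big_rem _ ks) /= leq_max ltnS leqnn.
suff -> : \sum_(0 <= k < L) e / 2 ^+ k.+1 = e - e / 2 ^+ L.
  by rewrite gerBl divr_ge0 ?exprn_ge0 // ltW.
elim: (L) => [|l IHl]; first by rewrite big_nil expr0 divr1 subrr.
rewrite big_nat_recr //= IHl exprS.
have : (2 : R) ^+ l != 0 by rewrite expf_neq0.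
by move: (2 ^+ l) => a a0; field.
Qed.

Lemma lebesgue_nullU N E :
  lebesgue_null N -> lebesgue_null E -> lebesgue_null (N `|` E).
Proof.
move=> nN nE.
have : lebesgue_null (\bigcup_(b : bool) (if b then N else E)).
  by apply: lebesgue_null_bigcup => -[].
by apply: lebesgue_null_sub => x [Nx|Ex]; [exists true|exists false].
Qed.

Lemma grid_cell (a w t : R) K : a <= t <= a + w *+ K.+1 ->
  exists k : 'I_K.+1, a + w *+ k <= t <= a + w *+ k.+1.
Proof.
move=> /andP[at_]; elim: K => [|K IHK] tb.
  by exists ord0; rewrite mulr0n addr0 at_.
have [/IHK[k kP]|/ltW tK] := lerP t (a + w *+ K.+1).
  by exists (widen_ord (leqnSn _) k).
by exists ord_max; rewrite tK.
Qed.

(** Cut the box [[-M, M]^I] into columns over a grid of mesh [w] in the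
    coordinates other than [i]. The part of [E] in one column has height
    [O(w)], so the columns together contribute a volume [O(w)]. *)
Lemma lipschitz_graph_null E (i : I) (M C : R) :
    (forall x l, E x -> `|x l| <= M) -> 0 <= C ->
    (forall x z eta, E x -> E z -> 0 <= eta ->
      (forall l, l != i -> `|x l - z l| <= eta) -> `|x i - z i| <= C * eta) ->
  lebesgue_null E.
Proof.
move=> EM C0 Elip; have [->|/set0P[x0 Ex0]] := eqVneq E set0.
  exact: lebesgue_null0.
have M0 : 0 <= M by apply: le_trans (EM x0 i Ex0).
apply: lebesgue_null_cover => e e0; pose W := M *+ 2.
have W0 : 0 <= W by rewrite mulrn_wge0.
pose V : R := \prod_(l | l != i) W.
have V0 : 0 <= V by apply: prodr_ge0.
have [K KP] : exists K : nat, 2 * C * W * V <= e * K.+1%:R.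
  exists (Num.truncn (2 * C * W * V / e)).
  by rewrite [leRHS]mulrC -ler_pdivrMr // ltW // truncnS_gt.
pose w := W / K.+1%:R.
have w0 : 0 <= w by rewrite divr_ge0.
have wK : w *+ K.+1 = W by rewrite /w -mulr_natr divfK ?pnatr_eq0.
pose cell (kk : {ffun I -> 'I_K.+1}) x :=
  forall l, l != i -> - M + w *+ kk l <= x l <= - M + w *+ (kk l).+1.
have /choice[r rP] kk : exists z, forall x, E x -> cell kk x -> E z /\ cell kk z.
  have [[x [Ex cx]]|nE] := pselect (exists x, E x /\ cell kk x).
    by exists x => ? ? ?.
  by exists (fun=> 0) => x Ex cx; case: nE; exists x.
(* The index [kk i] cuts nothing: the boxes with [kk i <> 0] are degenerate, so
   that the total volume is a product of sums over the coordinates. *)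
pose lo (kk : {ffun I -> 'I_K.+1}) l := if l != i then - M + w *+ kk l
  else if kk l == ord0 then r kk i - C * w else 0.
pose hi (kk : {ffun I -> 'I_K.+1}) l := if l != i then - M + w *+ (kk l).+1
  else if kk l == ord0 then r kk i + C * w else 0.
exists {ffun I -> 'I_K.+1}, xpredT, lo, hi.
have Cw0 : 0 <= C * w by rewrite mulr_ge0.
have lohi kk l : lo kk l <= hi kk l.
  rewrite /lo /hi; case: eqP => _ /=; last by rewrite lerD2l ler_wpMn2l.
  by case: eqP => // _; lra.
split=> // [x Ex|s us].
  have /choice[k kP] l : exists k : 'I_K.+1, - M + w *+ k <= x l <= - M + w *+ k.+1.
    by apply: grid_cell; rewrite wK /W mulr2n addKr -ler_norml EM.
  pose kk : {ffun I -> 'I_K.+1} := [ffun l => if l == i then ord0 else k l].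
  have cx : cell kk x by move=> l li; rewrite /kk ffunE (negPf li).
  exists kk => // l; rewrite /lo /hi; case: (eqVneq l i) => [->|li] /=; last exact: cx.
  have -> : kk i = ord0 by rewrite ffunE eqxx.
  rewrite eqxx -ler_distl.
  have [Er cr] := rP _ _ Ex cx; apply: Elip => // j ji.
  have := cx _ ji; have := cr _ ji; rewrite !mulrS ler_norml; lra.
apply: le_trans (_ : \sum_kk volume (lo kk) (hi kk) <= _).
  rewrite -big_enum /=; apply: ler_sum_uniq => // [kk _|kk]; first by rewrite mem_enum.
  exact: volume_ge0.
pose g l (k : 'I_K.+1) : R := if l != i then w else if k == ord0 then C * w *+ 2 else 0.
rewrite (eq_bigr (fun kk : {ffun I -> 'I_K.+1} => \prod_l g l (kk l))); last first.
  move=> kk _; apply: eq_bigr => l _; rewrite /lo /hi /g; case: eqP => _ /=.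
    by case: eqP => _; rewrite ?mulr2n; ring.
  by rewrite mulrS; ring.
rewrite -bigA_distr_bigA (bigD1 i) //= [X in _ * X](eq_bigr (fun=> W)); last first.
  by move=> l li; rewrite /g li sumr_const card_ord.
rewrite -/V /g eqxx /= -big_mkcond big_pred1_eq.
rewrite -(ler_pM2r (ltr0Sn R K)); apply: le_trans KP; rewrite le_eqVlt; apply/orP; left.
apply/eqP; rewrite -wK -mulr_natr; ring.
Qed.

End NullSetTheory.

(** * Algebraically independent coordinates *)

Section LipschitzFunctions.
Variables (R : realType) (I : finType).
Implicit Types (J : pred I) (f g : (I -> R) -> R) (x z : I -> R).

(** Lipschitz on bounded boxes, for the pseudo-distance that only looks at the
    coordinates in [J]; in particular [f] depends on these coordinates only. *)
Definition lipschitz_in J f : Prop :=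
  forall M : R, exists2 C, 0 <= C & forall x z eta, 0 <= eta ->
    (forall l, `|x l| <= M) -> (forall l, `|z l| <= M) ->
    (forall l, J l -> `|x l - z l| <= eta) -> `|f x - f z| <= C * eta.

Lemma lipschitz_in_sub J J' f :
  (forall l, J l -> J' l) -> lipschitz_in J f -> lipschitz_in J' f.
Proof.
move=> JJ' fJ M; have [C C0 CP] := fJ M; exists C => // x z eta eta0 xM zM xz.
by apply: CP => // l /JJ'/xz.
Qed.

Lemma lipschitz_in_cst J (c : R) : lipschitz_in J (fun=> c).
Proof. by move=> M; exists 0 => // x z eta _ _ _ _; rewrite subrr normr0 mul0r. Qed.

Lemma lipschitz_in_coord J i : J i -> lipschitz_in J (fun x => x i).
Proof. by move=> Ji M; exists 1 => // x z eta _ _ _ xz; rewrite mul1r xz. Qed.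

Lemma lipschitz_inD J f g : lipschitz_in J f -> lipschitz_in J g ->
  lipschitz_in J (fun x => f x + g x).
Proof.
move=> fJ gJ M; have [C C0 CP] := fJ M; have [D D0 DP] := gJ M.
exists (C + D) => [|x z eta eta0 xM zM xz]; first exact: addr_ge0.
rewrite opprD addrACA (le_trans (ler_normD _ _)) // mulrDl lerD //.
  exact: CP.
exact: DP.
Qed.

Lemma lipschitz_in_bounded J f (M : R) : lipschitz_in J f ->
  exists2 B, 0 <= B & forall x, (forall l, `|x l| <= M) -> `|f x| <= B.
Proof.
move=> /(_ `|M|)[C C0 CP]; exists (`|f (fun=> 0)| + C * `|M|).
  by rewrite addr_ge0 ?mulr_ge0.
move=> x xM; rewrite -(subrK (f (fun=> 0)) (f x)) addrC.
have xM' l : `|x l| <= `|M| by apply: le_trans (xM l) (ler_norm _).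
rewrite (le_trans (ler_normD _ _)) // lerD2l; apply: CP => // l; first by rewrite normr0.
by rewrite subr0.
Qed.

Lemma lipschitz_inM J f g : lipschitz_in J f -> lipschitz_in J g ->
  lipschitz_in J (fun x => f x * g x).
Proof.
move=> fJ gJ M; have [C C0 CP] := fJ M; have [D D0 DP] := gJ M.
have [B B0 BP] := lipschitz_in_bounded M fJ.
have [B' B'0 B'P] := lipschitz_in_bounded M gJ.
exists (B * D + B' * C) => [|x z eta eta0 xM zM xz].
  by rewrite addr_ge0 ?mulr_ge0.
have -> : f x * g x - f z * g z = f x * (g x - g z) + g z * (f x - f z) by ring.
rewrite (le_trans (ler_normD _ _)) // mulrDl !normrM -!mulrA lerD // ler_pM //.
- exact: BP.
- exact: DP.
- exact: B'P.
- exact: CP.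
Qed.

Lemma lipschitz_in_horner J (s : seq ((I -> R) -> R)) v :
    lipschitz_in J v -> (forall f, List.In f s -> lipschitz_in J f) ->
  lipschitz_in J (fun x => (Poly [seq f x | f <- s]).[v x]).
Proof.
move=> vJ; elim: s => [_|f s IHs fs] /=.
  have -> : (fun x => 0.[v x]) = (fun=> 0) by apply/funext => x; rewrite horner0.
  exact: lipschitz_in_cst.
under [X in lipschitz_in _ X]eq_fun do rewrite horner_cons.
apply: lipschitz_inD; last by apply: fs; left.
by apply: lipschitz_inM => //; apply: IHs => g gs; apply: fs; right.
Qed.

End LipschitzFunctions.

(** One constant serves for all points of a bounded set; this is what makes the
    isolation of simple roots uniform. *)
Lemma monomial_remainder (R : realType) (M : R) (k : nat) :
  exists2 B, 0 <= B & forall s t : R, `|s| <= M -> `|t| <= M ->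
    `|s ^+ k - t ^+ k - (s - t) * (t ^+ k.-1 *+ k)| <= B * `|s - t| ^+ 2.
Proof.
elim: k => [|k [B B0 BP]].
  by exists 0 => // s t _ _; rewrite !expr0 mulr0n mulr0 subrr subr0 normr0 mul0r.
exists (`|M| * B + `|M| ^+ k.-1 *+ k).
  by rewrite addr_ge0 ?mulr_ge0 ?mulrn_wge0 ?exprn_ge0.
move=> s t sM tM; rewrite !(exprS _ k) /=.
have -> : s * s ^+ k - t * t ^+ k - (s - t) * (t ^+ k *+ k.+1)
  = s * (s ^+ k - t ^+ k - (s - t) * (t ^+ k.-1 *+ k))
    + (t ^+ k.-1 *+ k) * (s - t) ^+ 2.
  case: k {B B0 BP} => [|k]; first by rewrite /= !expr0 !mulr0n mulr1n; ring.
  by rewrite /= !exprS !mulrS; ring.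
have MM : M <= `|M| by exact: ler_norm.
rewrite (le_trans (ler_normD _ _)) // [leRHS]mulrDl lerD // normrM.
  by rewrite -mulrA ler_pM //; [exact: le_trans sM MM | exact: BP].
rewrite normrX ler_wpM2r ?exprn_ge0 // normrMn lerMn2r normrX.
by rewrite lerXn2r ?nnegrE ?(le_trans tM) ?orbT.
Qed.

Section RootSets.
Variables (R : realType) (I : finType) (J : pred I) (i : I) (Ji : ~~ J i).
Implicit Types (x z : I -> R) (q : (I -> R) -> {poly R}).

Definition lipschitz_coefs (d : nat) q : Prop :=
  (forall x, (size (q x) <= d)%N) /\
  forall l, lipschitz_in J (fun x => (q x)`_l).

(** Where the derivative at the root is at least [mu] in absolute value and the
    roots are confined to an interval short compared with [mu], the root is a
    Lipschitz function of the coefficients. *)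
Lemma simple_root_piece d q (M mu : R) : lipschitz_coefs d q -> 0 < mu ->
  exists2 del, 0 < del & forall a, lebesgue_null [set x |
    [/\ (q x).[x i] = 0, mu <= `|(q x)^`().[x i]|,
        forall l, `|x l| <= M & a <= x i <= a + del]].
Proof.
move=> [qd qlip] mu0.
have /choice[C CP] l : exists C : R, 0 <= C /\ forall x z eta, 0 <= eta ->
    (forall l, `|x l| <= M) -> (forall l, `|z l| <= M) ->
    (forall l, J l -> `|x l - z l| <= eta) -> `|(q x)`_l - (q z)`_l| <= C * eta.
  by have [C C0 CP] := qlip l M; exists C.
have /choice[B BP] l : exists B : R, 0 <= B /\
    forall x, (forall l, `|x l| <= M) -> `|(q x)`_l| <= B.
  by have [B B0 BP] := lipschitz_in_bounded M (qlip l); exists B.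
have /choice[T TP] k : exists B : R, 0 <= B /\
    forall s t : R, `|s| <= M -> `|t| <= M ->
    `|s ^+ k - t ^+ k - (s - t) * (t ^+ k.-1 *+ k)| <= B * `|s - t| ^+ 2.
  by have [T0 T00 TP] := monomial_remainder M k; exists T0.
pose B2 := \sum_(k < d) B k * T k.
pose C2 := \sum_(k < d) C k * `|M| ^+ k.
have B20 : 0 <= B2.
  by apply: sumr_ge0 => k _; rewrite mulr_ge0 ?(BP _).1 ?(TP _).1.
have C20 : 0 <= C2.
  by apply: sumr_ge0 => k _; rewrite mulr_ge0 ?(CP _).1 ?exprn_ge0.
have taylor z s t : (forall l, `|z l| <= M) -> `|s| <= M -> `|t| <= M ->
    `|(q z).[s] - (q z).[t] - (s - t) * (q z)^`().[t]| <= B2 * `|s - t| ^+ 2.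
  move=> zM sM tM.
  have -> : (q z)^`().[t] = \sum_(k < d) (q z)`_k * (t ^+ k.-1 *+ k).
    have {1}-> : q z = \poly_(k < d) (q z)`_k.
      apply/polyP => j; rewrite coef_poly; case: ltnP => // /(leq_trans (qd z)).
      exact: nth_default.
    rewrite poly_def linear_sum horner_sum; apply: eq_bigr => k _.
    by rewrite linearZ /= derivXn hornerZ hornerMn hornerXn.
  rewrite !(horner_coef_wide _ (qd z)) mulr_sumr -!sumrB mulr_suml.
  apply: le_trans (ler_norm_sum _ _ _) (ler_sum _ _) => k _.
  rewrite mulrCA -!mulrBr normrM -mulrA ler_pM //; first exact: (BP _).2.
  exact: (TP _).2.
have shift x z s eta : 0 <= eta -> `|s| <= M ->
    (forall l, `|x l| <= M) -> (forall l, `|z l| <= M) ->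
    (forall l, J l -> `|x l - z l| <= eta) ->
    `|(q x).[s] - (q z).[s]| <= C2 * eta.
  move=> eta0 sM xM zM xz; rewrite !(horner_coef_wide _ (qd _)) -sumrB mulr_suml.
  apply: le_trans (ler_norm_sum _ _ _) (ler_sum _ _) => k _.
  rewrite -mulrBl normrM mulrAC ler_pM //; first exact: (CP _).2.
  by rewrite normrX lerXn2r ?nnegrE // (le_trans sM) // ler_norm.
(* On an interval of this length the quadratic error is at most half of the
   linear term. *)
pose del := mu / (2 * (B2 + 1)).
have B21 : 0 < B2 + 1 by rewrite ltr_wpDl.
have del0 : 0 < del by rewrite divr_gt0 // mulr_gt0.
exists del => // a.
apply: (@lipschitz_graph_null _ _ _ i M (2 * C2 / mu)).
- by move=> x l [].
- by rewrite divr_ge0 ?mulr_ge0 // ltW.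
move=> x z eta [qx _ xM /andP[ax xa]] [qz muz zM /andP[az za]] eta0 xz.
have xzJ l : J l -> `|x l - z l| <= eta.
  by move=> Jl; apply: xz; apply: contraNneq Ji => <-.
(* Compare [(q x).[x i] = 0 = (q z).[z i]] through [(q z).[x i]]. *)
have h1 := shift _ _ _ _ eta0 (xM i) xM zM xzJ.
have h2 := taylor _ _ _ zM (xM i) (zM i).
rewrite qx sub0r normrN in h1; rewrite qz subr0 in h2.
have h3 : `|x i - z i| * mu <= C2 * eta + B2 * `|x i - z i| ^+ 2.
  apply: le_trans (_ : `|(x i - z i) * (q z)^`().[z i]| <= _).
    by rewrite normrM ler_wpM2l.
  rewrite -[X in `|X|](subKr (q z).[x i]).
  by apply: le_trans (ler_normB _ _) _; rewrite lerD.
have h4 : `|x i - z i| <= del by rewrite ler_norml; lra.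
have h5 : B2 * `|x i - z i| ^+ 2 <= `|x i - z i| * (mu / 2).
  rewrite expr2 mulrA [X in X <= _]mulrC ler_wpM2l //.
  apply: le_trans (_ : (B2 + 1) * del <= _); first by rewrite ler_pM // lerDl.
  by rewrite /del le_eqVlt; apply/orP; left; apply/eqP; field; rewrite gt_eqF.
rewrite mulrAC ler_pdivlMr //; lra.
Qed.

Lemma simple_root_null d q : lipschitz_coefs d q ->
  lebesgue_null [set x | (q x).[x i] = 0 /\ (q x)^`().[x i] != 0].
Proof.
move=> qlip.
have j0 j : 0 < (j.+1%:R : R)^-1 by rewrite invr_gt0.
pose piece j del a := [set x |
    [/\ (q x).[x i] = 0, j.+1%:R^-1 <= `|(q x)^`().[x i]|,
        forall l, `|x l| <= j.+1%:R & a <= x i <= a + del]].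
have /choice[del delP] (j : nat) : exists del : R,
    0 < del /\ forall a, lebesgue_null (piece j del a).
  by have [del del0 delP] := simple_root_piece j.+1%:R qlip (j0 j); exists del.
have : lebesgue_null (\bigcup_(u : nat * int) piece u.1 (del u.1) (del u.1 * u.2%:~R)).
  by apply: lebesgue_null_bigcup => u; apply: (delP u.1).2.
apply: lebesgue_null_sub => x [qx q'x].
pose S := `|(q x)^`().[x i]|^-1 + \sum_l `|x l|.
have q'0 : 0 < `|(q x)^`().[x i]| by rewrite normr_gt0.
pose j := Num.truncn S; have Sj : S <= j.+1%:R by rewrite ltW // truncnS_gt.
have [dj _] := delP j.
exists (j, Num.floor (x i / del j)) => //; split=> //=.
- rewrite -[leRHS]invrK lef_pV2 ?posrE ?invr_gt0 //; apply: le_trans Sj.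
  by rewrite lerDl sumr_ge0.
- move=> l; apply: le_trans Sj; rewrite /S (bigD1 l) //= addrCA lerDl.
  by rewrite addr_ge0 ?invr_ge0 ?sumr_ge0.
- rewrite ![del j * _]mulrC -ler_pdivlMr // ge_floor /=.
  rewrite -[X in _ + X]mul1r -mulrDl -ler_pdivrMr //.
  by have /ltW := floorD1_gt (x i / del j); rewrite intrD.
Qed.

Lemma lipschitz_coefs_deriv d q : lipschitz_coefs d.+1 q ->
  lipschitz_coefs d (fun x => (q x)^`()).
Proof.
move=> [qd qlip]; split=> [x|l].
  apply/leq_sizeP => j dj; rewrite coef_deriv nth_default ?mul0rn //.
  by rewrite (leq_trans (qd x)).
under [X in lipschitz_in _ X]eq_fun do rewrite coef_deriv -mulr_natr.
by apply: lipschitz_inM => //; exact: lipschitz_in_cst.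
Qed.

(** A root is either simple, or a root of the nonzero derivative, which has
    smaller degree. *)
Lemma root_null d q : lipschitz_coefs d q ->
  lebesgue_null [set x | q x != 0 /\ (q x).[x i] = 0].
Proof.
elim: d => [|d IHd] in q *.
  move=> [qd _]; apply: (@lebesgue_null_sub _ _ set0) => [x [/=]|]; last exact: lebesgue_null0.
  by have := qd x; rewrite leqn0 size_poly_eq0 => /eqP ->; rewrite eqxx.
move=> qlip; apply: lebesgue_null_sub (lebesgue_nullU (simple_root_null qlip)
  (IHd _ (lipschitz_coefs_deriv qlip))) => x [/= qx0 qx].
have [q'x|q'x] := eqVneq (q x)^`().[x i] 0; last by left.
right; split=> //=; apply/eqP => /(congr1 (fun p : {poly R} => p`_(size (q x)).-2)).
case E: (size (q x)) => [|[|k]] /=.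
- by move/eqP: E; rewrite size_poly_eq0 (negPf qx0).
- have qE := size1_polyC (eq_leq E); rewrite qE hornerC in qx.
  by rewrite qE qx eqxx in qx0.
rewrite coef_deriv coef0 => /eqP; rewrite mulrn_eq0 /=.
by rewrite -[k.+1]/(k.+2.-1) -E -/(lead_coef _) lead_coef_eq0 (negPf qx0).
Qed.

End RootSets.

Section GenericPoints.
Variables (R : realType) (I : finType) (cs : seq R).

(** The ring generated by [cs] is countable, being built from the integers by
    finitely many simple extensions; it carries the zero derivation. *)
Lemma countable_constants : exists (e : nat -> R) (G : set (R * R)),
  [/\ derivation_graph G,
      forall c, c \in cs -> G (c, 0) &
      forall x u, G (x, u) -> u = 0 /\ exists k, x = e k].
Proof.
elim: cs => [|c s [e [G [GG Gs Ge]]]].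
  exists (fun k => (odflt 0 (unpickle k : option int))%:~R).
  exists [set z | z.2 = 0 /\ exists k : int, z.1 = k%:~R]; split=> //.
    split; last by move=> u [].
    split=> [|x u y v [/= -> [k ->]] [/= -> [l ->]]|
             x u y v [/= -> [k ->]] [/= -> [l ->]]] /=.
    - by split=> //; exists 1.
    - by rewrite subrr; split=> //; exists (k - l); rewrite intrB.
    - by rewrite mulr0 mul0r addr0; split=> //; exists (k * l); rewrite intrM.
  by move=> x u [/= -> [k ->]]; split=> //; exists (pickle k); rewrite pickleK.
have GR := GG.1.
exists (fun k => (Poly [seq e j | j <- odflt [::] (unpickle k : option (seq nat))]).[c]).
exists (adjoin G c 0).
have Glift p q : lifts G p q -> q = 0.
  by move=> Gpq; apply/polyP => j; rewrite coef0; case: (Ge _ _ (Gpq j)).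
split.
- apply: adjoin_graph => // p q /Glift -> _; rewrite horner0 mulr0 addr0 //.
- move=> x; rewrite inE => /orP[/eqP ->|xs]; first exact: mem_adjoin.
  exact/sub_adjoin/Gs.
- move=> x u [p [q [Gpq [-> ->]]]]; rewrite (Glift _ _ Gpq) horner0 mulr0 addr0.
  split=> //.
  have /choice[k kP] j : exists k, p`_j = e k by case: (Ge _ _ (Gpq j)).
  exists (pickle (mkseq k (size p))); rewrite pickleK /= -map_comp.
  congr (_.[_]); rewrite -[LHS]polyseqK; congr Poly.
  apply: (@eq_from_nth _ 0); first by rewrite size_map size_iota.
  by move=> j jp; rewrite (nth_map 0%N) ?size_iota //= nth_iota // add0n kP.
Qed.

(** Adjoin the coordinates in [s] one at a time. The ring reached at each stage
    is enumerated by functions [e k] of the earlier coordinates, so the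
    requirement that the next coordinate be transcendental over it excludes
    countably many sets covered by [root_null]. *)
Lemma generic_derivation_graph (s : seq I) : uniq s ->
  exists (e : nat -> (I -> R) -> R) (N : set (I -> R)),
  [/\ lebesgue_null N, forall k, lipschitz_in (fun i => i \in s) (e k) &
      forall x, ~ N x -> forall u : I -> R, exists G : set (R * R),
      [/\ derivation_graph G, forall c, c \in cs -> G (c, 0),
          forall i, i \in s -> G (x i, u i) &
          forall y v, G (y, v) -> exists k, y = e k x]].
Proof.
elim: s => [_|i s IHs /= /andP[is_ us]].
  have [e [G [GG Gcs Ge]]] := countable_constants.
  exists (fun k _ => e k), set0; split=> [|k|x _ u]; first exact: lebesgue_null0.
    exact: lipschitz_in_cst.
  by exists G; split=> // y v /Ge[].
have [e [N [N0 elip eP]]] := IHs us.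
pose q k x := Poly [seq e j x | j <- odflt [::] (unpickle k : option (seq nat))].
exists (fun k x => (q k x).[x i]).
exists (N `|` \bigcup_k [set x | q k x != 0 /\ (q k x).[x i] = 0]).
have lipS k : lipschitz_in (fun j => j \in i :: s) (e k).
  by apply: lipschitz_in_sub (elip k) => j js; rewrite inE js orbT.
split.
- apply: lebesgue_nullU => //; apply: lebesgue_null_bigcup => k.
  rewrite /q; move: (odflt _ _) => l.
  apply: (@root_null _ _ (fun j => j \in s) i is_ (size l)); split=> [x|j].
    by rewrite (leq_trans (size_Poly _)) // size_map.
  have [jl|jl] := ltnP j (size l); last first.
    have -> : (fun x => (Poly [seq e j x | j <- l])`_j) = (fun=> 0).
      by apply/funext => x; rewrite coef_Poly nth_default ?size_map.
    exact: lipschitz_in_cst.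
  have -> // : (fun x => (Poly [seq e j x | j <- l])`_j) = e (nth 0%N l j).
  by apply/funext => x; rewrite coef_Poly (nth_map 0%N).
- move=> k; rewrite /q; move: (odflt _ _) => l.
  have -> : (fun x => (Poly [seq e j x | j <- l]).[x i]) =
      (fun x => (Poly [seq f x | f <- [seq e j | j <- l]]).[x i]).
    by apply/funext => x; rewrite -map_comp.
  apply: (@lipschitz_in_horner _ _ _ _ (fun x => x i)).
    by apply: lipschitz_in_coord; rewrite mem_head.
  by move=> f /List.in_map_iff[j [<- _]].
- move=> x /not_orP[Nx qx] u; have [G [GG Gcs Gs Ge]] := eP x Nx u.
  have Gq p p' : lifts G p p' -> exists k, p = q k x.
    move=> Gpq; have /choice[k kP] j : exists k, p`_j = e k x by exact: Ge (Gpq j).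
    exists (pickle (mkseq k (size p))); rewrite /q pickleK /= -map_comp.
    rewrite -[LHS]polyseqK; congr Poly.
    apply: (@eq_from_nth _ 0); first by rewrite size_map size_iota.
    by move=> j jp; rewrite (nth_map 0%N) ?size_iota //= nth_iota // add0n kP.
  have GR := GG.1.
  exists (adjoin G (x i) (u i)); split.
  + apply: adjoin_transcendental => // p p' /Gq[k ->] qk0.
    by have [//|qkN0] := eqVneq (q k x) 0; case: qx; exists k.
  + by move=> c /Gcs; exact: sub_adjoin.
  + move=> j; rewrite inE => /orP[/eqP ->|/Gs]; first exact: mem_adjoin.
    exact: sub_adjoin.
  + by move=> y v [p [p' [/Gq[k ->] [-> _]]]]; exists k.
Qed.

Lemma generic_derivation : exists2 N : set (I -> R), lebesgue_null N &
  forall x, ~ N x -> forall u : I -> R, exists D : R -> R,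
    [/\ derivation D, forall c, c \in cs -> D c = 0 & forall i, D (x i) = u i].
Proof.
have [e [N [N0 _ eP]]] := generic_derivation_graph (enum_uniq I).
exists N => // x Nx u; have [G [GG Gcs Gs _]] := eP x Nx u.
have [D [DD DG]] := extend_derivation GG; exists D; split=> // [c /Gcs/DG //|i].
by apply/DG/Gs; rewrite mem_enum.
Qed.

End GenericPoints.

(** * Frobenius inner product and symmetric matrices *)

Section FrobeniusTheory.
Variable R : realType.

Lemma mxdotC p q (A B : 'M[R]_(p, q)) : mxdot A B = mxdot B A.
Proof. by rewrite /mxdot -mxtrace_tr trmx_mul trmxK. Qed.

Lemma mxdotDr p q (A B C : 'M[R]_(p, q)) : mxdot A (B + C) = mxdot A B + mxdot A C.
Proof. by rewrite /mxdot linearD /= mulmxDr linearD. Qed.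

Lemma mxdotZr p q a (A B : 'M[R]_(p, q)) : mxdot A (a *: B) = a * mxdot A B.
Proof. by rewrite /mxdot linearZ /= -scalemxAr linearZ. Qed.

Lemma mxdot0r p q (A : 'M[R]_(p, q)) : mxdot A 0 = 0.
Proof. by rewrite -(scale0r 0) mxdotZr mul0r. Qed.

Lemma mxdotNr p q (A B : 'M[R]_(p, q)) : mxdot A (- B) = - mxdot A B.
Proof. by rewrite -scaleN1r mxdotZr mulN1r. Qed.

Lemma mxdotBr p q (A B C : 'M[R]_(p, q)) : mxdot A (B - C) = mxdot A B - mxdot A C.
Proof. by rewrite mxdotDr mxdotNr. Qed.

Lemma mxdotBl p q (A B C : 'M[R]_(p, q)) : mxdot (A - B) C = mxdot A C - mxdot B C.
Proof. by rewrite !(mxdotC _ C) mxdotBr. Qed.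

Lemma mxdotDl p q (A B C : 'M[R]_(p, q)) : mxdot (A + B) C = mxdot A C + mxdot B C.
Proof. by rewrite !(mxdotC _ C) mxdotDr. Qed.

Lemma mxdot0l p q (A : 'M[R]_(p, q)) : mxdot 0 A = 0.
Proof. by rewrite mxdotC mxdot0r. Qed.

Lemma mxdot_tr p q (A B : 'M[R]_(p, q)) : mxdot A^T B^T = mxdot A B.
Proof. by rewrite mxdotC /mxdot trmxK mxtrace_mulC. Qed.

Lemma mxdot_mulr p q r (A : 'M[R]_(p, r)) (B : 'M_(p, q)) (C : 'M_(q, r)) :
  mxdot A (B *m C) = mxdot (B^T *m A) C.
Proof. by rewrite /mxdot trmx_mul mulmxA mxtrace_mulC mulmxA. Qed.

Lemma mxdot_ge0 p q (A : 'M[R]_(p, q)) : 0 <= mxdot A A.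
Proof. by rewrite mxdotE; do 2!(apply: sumr_ge0 => ? _); rewrite -expr2 sqr_ge0. Qed.

Lemma mxdot_eq0 p q (A : 'M[R]_(p, q)) : mxdot A A = 0 -> A = 0.
Proof.
rewrite mxdotE => /eqP; rewrite psumr_eq0 => [/allP A0|i _]; last first.
  by apply: sumr_ge0 => j _; rewrite -expr2 sqr_ge0.
apply/matrixP => i j; have := A0 i (mem_index_enum _).
rewrite psumr_eq0 => [/allP/(_ j (mem_index_enum _))|k _]; last first.
  by rewrite -expr2 sqr_ge0.
by rewrite -expr2 sqrf_eq0 mxE => /eqP.
Qed.

Lemma mxdot_mxvec p q (A B : 'M[R]_(p, q)) : mxdot (mxvec A) (mxvec B) = mxdot A B.
Proof.
rewrite !mxdotE big_ord1 pair_bigA /= (reindex _ (curry_mxvec_bij _ _)) /=.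
by apply: eq_bigr => -[i j] _; rewrite !mxvecE.
Qed.

Lemma fnorm_sqr p q (A : 'M[R]_(p, q)) : fnorm A ^+ 2 = mxdot A A.
Proof. by rewrite sqr_sqrtr // mxdot_ge0. Qed.

Lemma mxdot_CauchySchwarz p q (A B : 'M[R]_(p, q)) :
  mxdot A B ^+ 2 <= mxdot A A * mxdot B B.
Proof.
have [/mxdot_eq0 ->|B0] := eqVneq (mxdot B B) 0; first by rewrite !mxdot0r expr0n mulr0.
have Bgt0 : 0 < mxdot B B by rewrite lt_def B0 mxdot_ge0.
have := mxdot_ge0 (mxdot B B *: A - mxdot A B *: B).
rewrite mxdotBr !mxdotZr !mxdotBl !(mxdotC (_ *: _)) !mxdotZr (mxdotC B A) => h.
rewrite -(ler_pM2l Bgt0); lra.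
Qed.

Lemma mxdot_mul_le p q r (A : 'M[R]_(p, q)) (B : 'M[R]_(q, r)) :
  mxdot (A *m B) (A *m B) <= mxdot A A * mxdot B B.
Proof.
have rowE p' q' (C : 'M[R]_(p', q')) : mxdot C C = \sum_i mxdot (row i C) (row i C).
  rewrite mxdotE; apply: eq_bigr => i _; rewrite mxdotE big_ord1.
  by apply: eq_bigr => j _; rewrite !mxE.
rewrite -(mxdot_tr B) (rowE _ _ A) (rowE _ _ B^T) mulr_suml mxdotE.
apply: ler_sum => i _; rewrite mulr_sumr; apply: ler_sum => j _.
rewrite -expr2; apply: le_trans (mxdot_CauchySchwarz _ _).
rewrite le_eqVlt; apply/orP; left; apply/eqP; congr (_ ^+ 2).
by rewrite mxE mxdotE big_ord1; apply: eq_bigr => k _; rewrite !mxE.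
Qed.

(** The columns of the cokernel of the stacked matrices of [f] and [g] are,
    up to reshaping, matrices orthogonal to both images. *)
Lemma range_orthogonal p q p1 q1 p2 q2 (f : 'M[R]_(p1, q1) -> 'M[R]_(p, q))
    (g : 'M[R]_(p2, q2) -> 'M[R]_(p, q)) (T : 'M[R]_(p, q)) :
    linear f -> linear g ->
    (forall W, (forall B, mxdot W (f B) = 0) -> (forall B, mxdot W (g B) = 0) ->
      mxdot W T = 0) ->
  exists B1 B2, T = f B1 + g B2.
Proof.
move=> flin glin orth.
pose F : {linear _ -> _} := HB.pack f (GRing.isLinear.Build _ _ _ _ f flin).
pose G : {linear _ -> _} := HB.pack g (GRing.isLinear.Build _ _ _ _ g glin).
have dotE (W S : 'M[R]_(p, q)) : mxvec S *m (mxvec W)^T = (mxdot W S)%:M.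
  by rewrite [LHS]mx11_scalar mxdotC -mxdot_mxvec /mxdot trace_mx11.
have : (mxvec T <= col_mx (lin_mx F) (lin_mx G))%MS.
  rewrite submxE; apply/eqP; set K := cokermx _; apply/matrixP => i0 j.
  rewrite [RHS]mxE [i0]ord1; pose W := vec_mx (col j K)^T.
  have KE : col j K = (mxvec W)^T by rewrite vec_mxK trmxK.
  have : col_mx (lin_mx F) (lin_mx G) *m col j K = 0.
    by rewrite colE mulmxA mulmx_coker mul0mx.
  rewrite mul_col_mx -[0]col_mx0 => /eq_col_mx[FW GW].
  have WT : mxdot W T = 0.
    apply: orth => B.
      have := dotE W (F B); rewrite -mul_vec_lin -mulmxA -KE FW mulmx0.
      by move/matrixP/(_ 0 0); rewrite !mxE eqxx.
    have := dotE W (G B); rewrite -mul_vec_lin -mulmxA -KE GW mulmx0.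
    by move/matrixP/(_ 0 0); rewrite !mxE eqxx.
  have : col j (mxvec T *m K) 0 0 = 0.
    by rewrite colE -mulmxA -colE KE dotE WT mxE mul0rn.
  by rewrite mxE.
case/submxP => c; rewrite -[c]hsubmxK mul_row_col.
rewrite -[lsubmx c]vec_mxK -[rsubmx c]vec_mxK !mul_vec_lin -linearD.
by move=> /(can_inj mxvecK) ->; do 2!eexists.
Qed.

Lemma range_orthogonal1 p q p1 q1 (f : 'M[R]_(p1, q1) -> 'M[R]_(p, q))
    (T : 'M[R]_(p, q)) :
    linear f -> (forall W, (forall B, mxdot W (f B) = 0) -> mxdot W T = 0) ->
  exists B, T = f B.
Proof.
move=> flin orth; have glin : linear (fun _ : 'M[R]_0 => 0 : 'M[R]_(p, q)).
  by move=> a u v; rewrite scaler0 addr0.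
have [B [_ ->]] := range_orthogonal flin glin (fun W fW _ => orth W fW).
by exists B; rewrite addr0.
Qed.

Section Symmetric.
Variable n : nat.
Implicit Types (S X : 'S[R]_n) (M : 'M[R]_n).

Lemma sym_tr S : (S : 'M[R]_n)^T = S.
Proof. by apply/eqP; exact: (valP S). Qed.

Lemma mxdot_add_tr S M : mxdot S (add_tr M) = 2 * mxdot S M.
Proof. by rewrite /= mxdotDr -{2}(sym_tr S) mxdot_tr mulr2n mulrDl mul1r. Qed.

Lemma mxdot_sym S M : mxdot S M = \tr (S *m M).
Proof. by rewrite -mxdot_tr sym_tr /mxdot trmxK. Qed.

Lemma mul_sym0C S S' : (S : 'M[R]_n) *m S' = 0 -> (S' : 'M[R]_n) *m S = 0.
Proof. by move=> /(congr1 trmx); rewrite trmx_mul !sym_tr trmx0. Qed.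

Lemma add_tr_mul_linear p (X : 'S[R]_n) (A : {linear 'S[R]_n -> 'cV[R]_p}) :
  linear (fun B : 'M[R]_n => A (add_tr ((X : 'M[R]_n) *m B))).
Proof.
move=> a B B'; rewrite -linearP; congr (A _); apply: val_inj => /=.
by rewrite mulmxDr -scalemxAr !linearD /= !linearZ /= addrACA.
Qed.

Lemma mul_ker_basis S : (S : 'M[R]_n) *m ker_basis S = 0.
Proof.
apply: trmx_inj; rewrite trmx0 trmx_mul trmxK; apply/sub_kermxP.
by rewrite eq_row_base.
Qed.

Lemma congr_add_tr_mul0 p S M (V : 'M[R]_(n, p)) : (S : 'M[R]_n) *m V = 0 ->
  V^T *m add_tr ((S : 'M[R]_n) *m M) *m V = 0.
Proof.
move=> SV; have VS : V^T *m S = 0 by rewrite -(sym_tr S) -trmx_mul SV trmx0.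
rewrite /= mulmxDr mulmxDl trmx_mul sym_tr -!mulmxA SV !mulmx0 addr0.
by rewrite mulmxA VS mul0mx.
Qed.

Lemma add_tr_lin_tangent S M : lin_tangent S (add_tr ((S : 'M[R]_n) *m M)).
Proof. exact/congr_add_tr_mul0/mul_ker_basis. Qed.

End Symmetric.
End FrobeniusTheory.

(** * Transversality at generic data *)

Section MatrixDerivation.
Variables (R : realType) (D : R -> R) (DD : derivation D).

Lemma derivation0 : D 0 = 0.
Proof. by apply: (addrI (D 0)); rewrite -DD.1 !addr0. Qed.

Lemma derivation_sum (T : Type) (s : seq T) (f : T -> R) :
  D (\sum_(i <- s) f i) = \sum_(i <- s) D (f i).
Proof. exact: (big_morph D DD.1 derivation0). Qed.

Lemma map_derivationM p q r (M : 'M[R]_(p, q)) (N : 'M[R]_(q, r)) :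
  map_mx D (M *m N) = M *m map_mx D N + map_mx D M *m N.
Proof.
apply/matrixP => i j; rewrite !mxE derivation_sum -big_split /=.
by apply: eq_bigr => k _; rewrite !mxE DD.2.
Qed.

Lemma map_derivation0 p q : map_mx D (0 : 'M[R]_(p, q)) = 0.
Proof. by apply/matrixP => i j; rewrite !mxE derivation0. Qed.

Lemma derivation_mxdot p q (M N : 'M[R]_(p, q)) :
  D (mxdot M N) = mxdot M (map_mx D N) + mxdot (map_mx D M) N.
Proof.
have Dtr k (K : 'M[R]_k) : D (\tr K) = \tr (map_mx D K).
  by rewrite derivation_sum; apply: eq_bigr => i _; rewrite mxE.
by rewrite Dtr map_derivationM linearD /= -map_trmx.
Qed.

Lemma map_derivation_sym_subproof n (S : 'S[R]_n) : map_mx D S \in @sym_pred R n.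
Proof. by rewrite unfold_in map_trmx sym_tr. Qed.

Definition map_derivation_sym n (S : 'S[R]_n) : 'S[R]_n :=
  SymMx (map_derivation_sym_subproof S).

(** Write [V = V K V]: by the Leibniz rule each term of [D V] has a factor [V]
    at one of its two ends, and under the trace it meets [U]. *)
Lemma trace_mul_derivation n (U V : 'M[R]_n) : U *m V = 0 -> V *m U = 0 ->
  \tr (U *m map_mx D V) = 0.
Proof.
move=> UV VU; have [K VE] : exists K, V *m K *m V = V by exists (pinvmx V); rewrite mulmxKpV.
rewrite -[X in map_mx D X]VE !map_derivationM mulmxDl !mulmxDr !mulmxA UV !mul0mx !add0r.
by rewrite mxtrace_mulC !mulmxA VU !mul0mx mxtrace0.
Qed.

End MatrixDerivation.

Section Transversality.
Variables (R : realType) (n m : nat) (A : {linear 'S[R]_n -> 'cV[R]_m}).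

(** The constants of the problem: a derivation that kills them commutes with
    [A] and with its adjoint. *)
Definition adjoint_entries : seq R :=
  [seq adjoint A (delta_mx u.1 0) u.2.1 u.2.2 | u <- enum {: 'I_m * ('I_n * 'I_n)}].

Lemma mxdot_cV (y w : 'cV[R]_m) : mxdot y w = \sum_k y k 0 * w k 0.
Proof. by rewrite mxdotE; apply: eq_bigr => k _; rewrite big_ord1. Qed.

Lemma mxdot_delta (w : 'cV[R]_m) k : mxdot (delta_mx k 0) w = w k 0.
Proof.
rewrite mxdot_cV (bigD1 k) //= mxE !eqxx mul1r big1 ?addr0 // => j jk.
by rewrite mxE (negPf jk) mul0r.
Qed.

Lemma adjointE y i j :
  adjoint A y i j = \sum_k y k 0 * adjoint A (delta_mx k 0) i j.
Proof.
rewrite mxE mxdot_cV mulr_sumr; apply: eq_bigr => k _.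
by rewrite mxE mxdot_delta mulrCA.
Qed.

Lemma forwardE (X : 'S[R]_n) k :
  A X k 0 = \sum_i \sum_j adjoint A (delta_mx k 0) i j * X i j.
Proof. by rewrite -mxdot_delta -adjointP mxdotE. Qed.

Lemma adjoint_linear : linear (fun y => adjoint A y : 'M[R]_n).
Proof.
move=> a u v; apply/matrixP => i j; rewrite !mxE !mxdot_cV !mulr_sumr.
rewrite -big_split /=; apply: eq_bigr => k _; rewrite !mxE; ring.
Qed.

Section Derivation.
Variables (D : R -> R) (DD : derivation D).
Hypothesis DA : forall c, c \in adjoint_entries -> D c = 0.

Lemma derivation_adjoint_entry k i j : D (adjoint A (delta_mx k 0) i j) = 0.
Proof. by apply: DA; apply/mapP; exists (k, (i, j)); rewrite ?mem_enum. Qed.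

Lemma map_derivation_adjoint y :
  map_mx D (adjoint A y) = adjoint A (map_mx D y).
Proof.
apply/matrixP => i j; rewrite [LHS]mxE !adjointE derivation_sum //.
apply: eq_bigr => k _; rewrite DD.2 derivation_adjoint_entry mulr0 add0r.
by congr (_ * _); rewrite mxE.
Qed.

Lemma map_derivation_forward (X : 'S[R]_n) :
  map_mx D (A X) = A (map_derivation_sym D X).
Proof.
apply/matrixP => k j0; rewrite [j0]ord1 mxE !forwardE derivation_sum //.
apply: eq_bigr => i _; rewrite derivation_sum //; apply: eq_bigr => j _.
by rewrite DD.2 derivation_adjoint_entry mul0r addr0; congr (_ * _); rewrite mxE.
Qed.

Lemma primal_transversal_derivation (b : 'cV[R]_m) (X : 'S[R]_n) (y : 'cV[R]_m) :
    A X = b -> map_mx D b = y -> (adjoint A y : 'M[R]_n) *m X = 0 -> y = 0.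
Proof.
move=> AX Db yX; apply: mxdot_eq0; rewrite -{2}Db.
have by0 : mxdot y b = 0 by rewrite -AX -adjointP mxdot_sym yX mxtrace0.
have := derivation_mxdot DD y b; rewrite by0 derivation0 //.
suff -> : mxdot (map_mx D y) b = 0 by rewrite addr0 => <-.
rewrite -AX -adjointP -map_derivation_adjoint.
have : \tr (map_mx D (adjoint A y *m X)) = 0 by rewrite yX map_derivation0 // linear0.
rewrite map_derivationM // linearD /= trace_mul_derivation ?add0r //; last first.
  exact: (mul_sym0C (S := adjoint A y)).
by move=> yX'; rewrite (mxdot_sym (map_derivation_sym D (adjoint A y))).
Qed.

Lemma dual_transversal_derivation (C W : 'S[R]_n) (y : 'cV[R]_m) :
    map_mx D C = W -> A W = 0 -> (C - adjoint A y : 'S[R]_n) *m W = 0 ->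
  W = 0.
Proof.
move=> DC AW ZW; suff W0 : (W : 'M[R]_n) = 0 by apply: val_inj.
apply: mxdot_eq0; rewrite -{1}DC.
have CE (S : 'S[R]_n) : mxdot C S = mxdot (C - adjoint A y : 'S[R]_n) S + mxdot y (A S).
  by rewrite /= mxdotBl adjointP subrK.
have CW : mxdot C W = 0 by rewrite CE AW mxdot0r addr0 mxdot_sym ZW mxtrace0.
have := derivation_mxdot DD C W; rewrite CW derivation0 //.
suff -> : mxdot C (map_mx D W) = 0 by rewrite add0r => <-.
rewrite -[map_mx D W]/(map_derivation_sym D W : 'M[R]_n) CE.
rewrite -map_derivation_forward AW map_derivation0 // mxdot0r addr0.
by rewrite mxdot_sym trace_mul_derivation // (mul_sym0C ZW).
Qed.

End Derivation.

(** Orthogonal complement form of nondegeneracy: [A^*(y)] is orthogonal to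
    [lin_tangent X] exactly when [A^*(y) X = 0]. *)
Definition primal_transversal (X : 'S[R]_n) : Prop :=
  forall y, (adjoint A y : 'M[R]_n) *m X = 0 -> y = 0.

(** Orthogonal complement form of dual nondegeneracy: the orthogonal complement
    of [lin_tangent Z] consists of the [W] with [Z W = 0]. *)
Definition dual_transversal (Z : 'S[R]_n) : Prop :=
  forall W : 'S[R]_n, A W = 0 -> (Z : 'M[R]_n) *m W = 0 -> W = 0.

(** The directions [X B + B^T X] already suffice; they are tangent at [X]. *)
Lemma primal_transversal_onto (X : 'S[R]_n) : primal_transversal X ->
  forall w, exists B, w = A (add_tr ((X : 'M[R]_n) *m B)).
Proof.
move=> Xtr w; apply: range_orthogonal1 => [|y yf]; first exact: add_tr_mul_linear.
suff -> : y = 0 by rewrite mxdot0l.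
apply: Xtr; apply: mul_sym0C; apply: mxdot_eq0.
have := yf ((X : 'M[R]_n) *m adjoint A y); rewrite -adjointP mxdot_add_tr.
rewrite mxdot_mulr sym_tr => /eqP; rewrite mulf_eq0 pnatr_eq0 /=.
by move=> /eqP.
Qed.

Lemma primal_transversal_nondegenerate (X : 'S[R]_n) :
  primal_transversal X -> primal_nondegenerate A X.
Proof.
move=> /primal_transversal_onto Xtr; apply/seteqP; split=> // w _.
have [B wE] := Xtr w; exists (add_tr ((X : 'M[R]_n) *m B)) => //.
exact: add_tr_lin_tangent.
Qed.

Lemma dual_transversal_nondegenerate (C : 'S[R]_n) y :
  dual_transversal (C - adjoint A y) -> dual_nondegenerate A C y.
Proof.
set Z := (C - adjoint A y : 'S[R]_n) => Ztr; apply/seteqP; split=> // T _.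
have [|W Wadj WZ|z [B TE]] := @range_orthogonal _ _ _ _ _ _ _
    (fun z => adjoint A z) (fun B => add_tr ((Z : 'M[R]_n) *m B) : 'M[R]_n) T adjoint_linear.
- move=> a B B'; rewrite /= mulmxDr -scalemxAr !linearD /= !linearZ /=.
  by rewrite addrACA.
- have half0 (a : R) : 2 * a = 0 -> a = 0.
    by move/eqP; rewrite mulf_eq0 pnatr_eq0 /= => /eqP.
  suff S0 : add_tr W = 0.
    rewrite mxdotC; apply: half0; rewrite -mxdot_add_tr S0; exact: mxdot0r.
  apply: Ztr; apply: mxdot_eq0.
    by rewrite -adjointP mxdot_add_tr mxdotC Wadj mulr0.
  set S := add_tr W; have := WZ ((Z : 'M[R]_n) *m S).
  set M := _ *m (_ *m _) => WM.
  rewrite -{1}(sym_tr Z) -mxdot_mulr -/M /S /= mxdotDl -[X in _ + X]mxdot_tr trmxK.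
  by rewrite -mxdotDr.
exists z => //; exists (add_tr ((Z : 'M[R]_n) *m B)); first exact: add_tr_lin_tangent.
by apply: val_inj; exact: esym TE.
Qed.

End Transversality.

(** * Multipliers from primal transversality *)

Section PositiveSemidefinite.
Variables (R : realType) (n : nat).
Implicit Types (X S H : 'S[R]_n) (B : 'M[R]_n).

Definition quad (M : 'M[R]_n) (v : 'cV[R]_n) : R := (v^T *m M *m v) 0 0.

Lemma quadD M N v : quad (M + N) v = quad M v + quad N v.
Proof. by rewrite /quad mulmxDr mulmxDl mxE. Qed.

Lemma quadZ a M v : quad (a *: M) v = a * quad M v.
Proof. by rewrite /quad -scalemxAr -scalemxAl mxE. Qed.

Lemma psdD X S : psd X -> psd S -> psd (X + S).
Proof. by move=> X0 S0 v; rewrite -/(quad _ _) /= quadD addr_ge0 // ?X0 ?S0. Qed.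

Lemma psdZ a X : 0 <= a -> psd X -> psd (a *: X).
Proof. by move=> a0 X0 v; rewrite -/(quad _ _) /= quadZ mulr_ge0 // X0. Qed.

Fact congr_sym_subproof p (X : 'S[R]_n) (L : 'M[R]_(n, p)) :
  L^T *m X *m L \in @sym_pred R p.
Proof. by rewrite unfold_in !trmx_mul trmxK sym_tr mulmxA. Qed.

Definition congr_sym p X (L : 'M[R]_(n, p)) : 'S[R]_p := SymMx (congr_sym_subproof X L).

Lemma psd_gram p (L : 'M[R]_(n, p)) : psd (gram L).
Proof.
move=> v; rewrite /= mulmxA -mulmxA -[X in X *m _]trmxK trmx_mul trmxK.
by rewrite -trace_mx11 mxtrace_mulC -[X in X *m _]trmxK mxtrace_mulC; apply: mxdot_ge0.
Qed.

Lemma mxdot_psd_gram X p (L : 'M[R]_(n, p)) : psd X -> 0 <= mxdot X (gram L).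
Proof.
move=> X0; rewrite mxdot_sym /= mulmxA mxtrace_mulC mulmxA.
apply: sumr_ge0 => j _; have := X0 (col j L).
suff -> : (L^T *m X *m L) j j = ((col j L)^T *m X *m col j L) 0 0 by [].
by rewrite tr_col -!row_mul colE mulmxA -colE !mxE.
Qed.

End PositiveSemidefinite.

Lemma psd_congr (R : realType) n p (X : 'S[R]_n) (L : 'M[R]_(n, p)) :
  psd X -> psd (congr_sym X L).
Proof. by move=> X0 v; have := X0 (L *m v); rewrite trmx_mul /= !mulmxA. Qed.

Section RadialCone.
Variables (R : realType) (n : nat) (X : 'S[R]_n) (X0 : psd X).
Implicit Types (H : 'S[R]_n) (B : 'M[R]_n).

(** The directions along which one can leave [X] on a segment inside the
    positive semidefinite cone. *)
Definition radial_cone H : Prop := exists2 t : R, 0 < t & psd (X + t *: H).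

Lemma radial_coneD H H' : radial_cone H -> radial_cone H' -> radial_cone (H + H').
Proof.
move=> [t t0 Ht] [s s0 Hs]; have ts0 : 0 < t + s by rewrite addr_gt0.
exists (t * s / (t + s)); first by rewrite divr_gt0 ?mulr_gt0.
have -> : X + (t * s / (t + s)) *: (H + H')
  = (s / (t + s)) *: (X + t *: H) + (t / (t + s)) *: (X + s *: H').
  have e : s / (t + s) + t / (t + s) = 1 by rewrite -mulrDl addrC mulfV ?gt_eqF.
  rewrite !scalerDr !scalerA [s / _ * t]mulrAC [s * t]mulrC [t / _ * s]mulrAC.
  by rewrite addrACA -scalerDl e scale1r.
by apply: psdD; apply: psdZ => //; rewrite divr_ge0 // ltW.
Qed.

Lemma radial_cone_psd H : psd H -> radial_cone H.
Proof. by move=> H0; exists 1 => //; rewrite scale1r; exact: psdD. Qed.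

Lemma radial_coneZ a H : 0 <= a -> radial_cone H -> radial_cone (a *: H).
Proof.
rewrite le_eqVlt => /predU1P[<- _|a0 [t t0 Ht]].
  by exists 1 => //; rewrite scale0r scaler0 addr0.
exists (t / a); first exact: divr_gt0.
by rewrite scalerA divfK ?gt_eqF.
Qed.

Lemma radial_cone_sum (I : finType) (H : I -> 'S[R]_n) :
  (forall i, radial_cone (H i)) -> radial_cone (\sum_i H i).
Proof.
move=> HK; elim/big_ind: _ => // [|]; last exact: radial_coneD.
by exists 1 => //; rewrite scaler0 addr0.
Qed.

(** [(1 + t B)^T X (1 + t B)] is a curve inside the cone with tangent
    [X B + B^T X] at [X]; the correction is its second-order term. *)
Lemma radial_cone_tangent B (t : R) : 0 < t ->
  radial_cone (add_tr ((X : 'M[R]_n) *m B) + t *: congr_sym X B).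
Proof.
move=> t0; exists t => //.
have -> : X + t *: (add_tr ((X : 'M[R]_n) *m B) + t *: congr_sym X B)
    = congr_sym X (1%:M + t *: B).
  apply: val_inj; rewrite /= [(_ + t *: B)^T]linearD linearZ /= trmx1.
  rewrite mulmxDl mul1mx !mulmxDr !mulmx1 mulmxDl -!scalemxAl -!scalemxAr.
  rewrite trmx_mul sym_tr !scalerDr !addrA.
  by congr (_ + _); rewrite addrAC.
exact: psd_congr.
Qed.

Variables (m : nat) (A : {linear 'S[R]_n -> 'cV[R]_m}).
Hypothesis onto : forall w, exists B, w = A (add_tr ((X : 'M[R]_n) *m B)).

(** Choose [B_k] whose tangent direction [T_k] is mapped to the [k]-th basis
    vector. The radial cone contains [+- T_k + s Q_k] with [Q_k] the
    second-order terms. A combination with coefficients [(c +- be_k) / 2] has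
    image [be + s c v], where [v] is the image of the sum of the [Q_k]. This
    equals [w] for [be = w - s c v], and the coefficients are nonnegative when
    [c] is large compared with [w] and [s] is small compared with [v]. *)
Lemma radial_cone_onto w : exists2 H, radial_cone H & A H = w.
Proof.
have /choice[B BP] k := onto (delta_mx k 0).
pose Q k := congr_sym X (B k); pose v := \sum_k A (Q k).
pose sv := \sum_k `|v k 0|; pose sw := \sum_k `|w k 0|.
have sv0 : 0 <= sv by exact: sumr_ge0.
have sw0 : 0 <= sw by exact: sumr_ge0.
pose s := (2 * (sv + 1))^-1; pose c := 2 * sw.
have s0 : 0 < s by rewrite invr_gt0 mulr_gt0 // ltr_wpDl.
pose be k := w k 0 - s * c * v k 0.
have be_c k : `|be k| <= c.
  have wk : `|w k 0| <= sw by rewrite /sw (bigD1 k) //= lerDl sumr_ge0.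
  have vk : `|v k 0| <= sv by rewrite /sv (bigD1 k) //= lerDl sumr_ge0.
  apply: le_trans (ler_normB _ _) _; rewrite normrM (ger0_norm (x := s * c)); last first.
    by rewrite mulr_ge0 ?mulr_ge0 // ltW.
  have : s * c * `|v k 0| <= sw; last by rewrite /c; lra.
  have -> : s * c * `|v k 0| = sw * (2 * s * `|v k 0|) by rewrite /c; ring.
  rewrite ler_piMr // /s invfM mulrA mulfV // mul1r mulrC ler_pdivrMr ?ltr_wpDl //.
  by rewrite mul1r (le_trans vk) // lerDl.
pose H k := ((c + be k) / 2) *: (add_tr ((X : 'M[R]_n) *m B k) + s *: Q k)
  + ((c - be k) / 2) *: (add_tr ((X : 'M[R]_n) *m (- B k)) + s *: congr_sym X (- B k)).
have QN k : congr_sym X (- B k) = Q k.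
  by apply: val_inj; rewrite /= mulmxN [(- B k)^T]linearN /= !mulNmx opprK.
have TN k : add_tr ((X : 'M[R]_n) *m (- B k)) = - add_tr ((X : 'M[R]_n) *m B k).
  by apply: val_inj; rewrite /= mulmxN linearN /= opprD.
exists (\sum_k H k).
  apply: radial_cone_sum => k; have := be_c k; rewrite ler_norml => bc.
  by apply: radial_coneD; apply: radial_coneZ;
     [lra|exact: radial_cone_tangent|lra|exact: radial_cone_tangent].
have AH k : A (H k) = be k *: delta_mx k 0 + (s * c) *: A (Q k).
  rewrite BP -!linearZ -linearD; congr (A _).
  rewrite /H QN TN !scalerDr scalerN !scalerA addrACA -scalerBl -scalerDl.
  by congr (_ *: _ + _ *: _); lra.
rewrite linear_sum (eq_bigr _ (fun k _ => AH k)) big_split /= -scaler_sumr -/v.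
apply/matrixP => i j; rewrite [j]ord1 !mxE summxE (bigD1 i) //= !mxE !eqxx mulr1.
rewrite big1 ?addr0 => [|k ki]; last by rewrite !mxE eq_sym (negPf ki) mulr0.
by rewrite /be subrK.
Qed.

Variables (b : 'cV[R]_m) (C : 'S[R]_n).
Hypothesis Xopt : primal_optimal A b C X.

Lemma optimal_radial H : radial_cone H -> A H = 0 -> 0 <= mxdot C H.
Proof.
move=> [t t0 Ht] AH; have [[AX _] Xmin] := Xopt.
have := Xmin (X + t *: H); rewrite /= mxdotDr mxdotZr lerDl pmulr_rge0 //.
by apply; split=> //; rewrite linearD linearZ /= AH scaler0 addr0.
Qed.

(** First-order optimality along directions that are only limits of radial
    ones: the error of order [t] in the constraint is cancelled by [t K], with
    [K] a radial direction independent of [t], and then [t] tends to 0. *)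
Lemma optimal_tangent B T : psd T -> A (add_tr ((X : 'M[R]_n) *m B) + T) = 0 ->
  0 <= mxdot C (add_tr ((X : 'M[R]_n) *m B) + T : 'S[R]_n).
Proof.
move=> T0 AT; have [K KK AK] := radial_cone_onto (- A (congr_sym X B)).
set H := add_tr _ in AT *; set be := mxdot C (congr_sym X B + K : 'S[R]_n).
have lim (t : R) : 0 < t -> 0 <= mxdot C (H + T : 'S[R]_n) + t * be.
  move=> t0; rewrite -mxdotZr -mxdotDr.
  apply: (@optimal_radial (H + T + t *: (congr_sym X B + K))).
    rewrite scalerDr addrACA; apply: radial_coneD; first exact: radial_cone_tangent.
    by apply: radial_coneD; [exact: radial_cone_psd|apply: radial_coneZ => //; exact: ltW].
  by rewrite linearD AT linearZ /= linearD AK subrr scaler0 addr0.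
rewrite leNgt; apply/negP => a0; set a := mxdot _ _ in lim a0.
have b1 : 0 < `|be| + 1 by rewrite ltr_wpDl.
(* At this [t] the error [t * be] is at most half of [- a]. *)
pose t := - a / (2 * (`|be| + 1)).
have t0 : 0 < t by rewrite divr_gt0 ?oppr_gt0 // mulr_gt0.
have tb : t * be <= - a / 2.
  apply: le_trans (_ : t * (`|be| + 1) <= _).
    by rewrite ler_wpM2l ?(ltW t0) // (le_trans (ler_norm _)) // lerDl.
  by rewrite /t invfM mulrA mulfVK ?gt_eqF.
have := lim t t0; lra.
Qed.

(** Tangent directions in the kernel of [A] come with both signs, so [C] is
    orthogonal to them, which yields [lam] with [Z X = 0]. Adding [v v^T] to a
    tangent direction shows that [Z] is positive semidefinite, since [Z] is
    orthogonal to the tangent part. *)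
Lemma optimal_multiplier : exists lam : 'cV[R]_m,
  psd (C - adjoint A lam) /\ (C - adjoint A lam : 'S[R]_n) *m X = 0.
Proof.
have psd0 : psd (0 : 'S[R]_n) by move=> v; rewrite mulmx0 mul0mx mxE.
have tan0 B : A (add_tr ((X : 'M[R]_n) *m B)) = 0 ->
    mxdot C (add_tr ((X : 'M[R]_n) *m B)) = 0.
  move=> AB; apply: le_anti; apply/andP; split; last first.
    by have := @optimal_tangent B 0 psd0; rewrite addr0; exact.
  have := @optimal_tangent (- B) 0 psd0; rewrite addr0 mulmxN.
  have -> : add_tr (- ((X : 'M[R]_n) *m B)) = - add_tr ((X : 'M[R]_n) *m B).
    by apply: val_inj; rewrite /= linearN /= opprD.
  by rewrite linearN AB oppr0 /= mxdotNr oppr_ge0; exact.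
have [|W WA|lam XC] := @range_orthogonal1 _ _ _ _ _
    (fun lam => (X : 'M[R]_n) *m adjoint A lam) ((X : 'M[R]_n) *m C).
- by move=> a u w; rewrite adjoint_linear mulmxDr -scalemxAr.
- have XW S : mxdot W ((X : 'M[R]_n) *m (S : 'S[R]_n))
      = 2^-1 * mxdot S (add_tr ((X : 'M[R]_n) *m W)).
    by rewrite mxdot_add_tr mulKf ?pnatr_eq0 // mxdot_mulr sym_tr mxdotC.
  rewrite XW tan0 ?mulr0 //; apply: mxdot_eq0; rewrite -adjointP.
  have := WA (A (add_tr ((X : 'M[R]_n) *m W))); rewrite XW => /eqP.
  by rewrite mulf_eq0 invr_eq0 pnatr_eq0 /= => /eqP.
pose Z := (C - adjoint A lam : 'S[R]_n).
have XZ : (X : 'M[R]_n) *m Z = 0 by rewrite /= mulmxBr XC subrr.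
exists lam; split; last exact: mul_sym0C XZ.
move=> v; have [B BP] := onto (- A (gram v)).
have := @optimal_tangent B (gram v) (@psd_gram _ _ _ v).
rewrite linearD -BP addNr => /(_ erefl).
have CE (S : 'S[R]_n) : mxdot C S = mxdot Z S + mxdot lam (A S).
  by rewrite /= mxdotBl adjointP subrK.
rewrite CE linearD -BP addNr mxdot0r addr0 /= mxdotDr.
rewrite (mxdot_add_tr Z) mxdot_mulr sym_tr XZ mxdot0l mulr0 add0r.
by rewrite (mxdot_sym Z) mulmxA mxtrace_mulC mulmxA trace_mx11.
Qed.

End RadialCone.

(** * Quadratic growth *)

Section Growth.
Variables (R : realType) (n m : nat) (A : {linear 'S[R]_n -> 'cV[R]_m}).

(** Evaluate the nonnegative form at the gradient step [L - k^-1 Z L]. *)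
Lemma psd_residual_bound (Z : 'S[R]_n) : psd Z -> exists2 k : R, 0 < k &
  forall p (L : 'M[R]_(n, p)),
    mxdot ((Z : 'M[R]_n) *m L) ((Z : 'M[R]_n) *m L) <= k * mxdot Z (gram L).
Proof.
move=> Z0; pose k := fnorm Z + 1.
have f0 : 0 <= fnorm Z by exact: sqrtr_ge0.
have k0 : 0 < k by rewrite ltr_wpDl.
exists k => // p L; set N := (Z : 'M[R]_n) *m L.
have gE (K : 'M[R]_(n, p)) : mxdot Z (gram K) = mxdot K ((Z : 'M[R]_n) *m K).
  by rewrite [RHS]mxdotC mxdot_sym /mxdot /= mulmxA.
have ZN : mxdot N ((Z : 'M[R]_n) *m N) <= fnorm Z * mxdot N N.
  rewrite -(ler_pXn2r (n := 2)) ?nnegrE ?mulr_ge0 ?mxdot_ge0 // -?gE ?mxdot_psd_gram //.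
  rewrite gE; apply: le_trans (mxdot_CauchySchwarz _ _) _.
  rewrite exprMn fnorm_sqr expr2 mulrCA ler_wpM2l ?mxdot_ge0 //.
  exact: mxdot_mul_le.
have := mxdot_psd_gram (L - k^-1 *: N) Z0.
rewrite gE mulmxBr -scalemxAr -/N !mxdotBr !mxdotBl !mxdotZr !(mxdotC (_ *: _)) !mxdotZr.
rewrite (mxdot_mulr L (Z : 'M[R]_n) N) sym_tr -/N (mxdotC (_ *m N)).
move: (mxdot_ge0 N) ZN; rewrite -[mxdot L N]gE.
move: (mxdot N N) (mxdot N (_ *m N)) (mxdot Z _) => nn z q nn0 zn h.
(* The step [k^-1] with [k > |Z|] makes the second-order term at most half of
   the first-order one. *)
have zk : k^-1 * (k^-1 * z) <= k^-1 * nn.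
  rewrite ler_wpM2l ?invr_ge0 ?(ltW k0) // mulrC ler_pdivrMr //.
  by rewrite mulrC (le_trans zn) // ler_wpM2r // /k lerDl.
have : k^-1 * nn <= q by lra.
by rewrite mulrC ler_pdivrMr // mulrC.
Qed.

(** An injective linear map between finite-dimensional spaces is bounded below:
    the matrix of [M |-> (Z M, A (M + M^T), M - M^T)] has a right inverse. The
    last component confines the kernel to symmetric matrices. *)
Lemma dual_transversal_bound (Z : 'S[R]_n) : dual_transversal A Z ->
  exists2 k : R, 0 <= k & forall W : 'S[R]_n, A W = 0 ->
    mxdot W W <= k * mxdot ((Z : 'M[R]_n) *m W) ((Z : 'M[R]_n) *m W).
Proof.
move=> Ztr.
have flin : linear (fun M : 'M[R]_n => A (add_tr M)).
  move=> a M N; rewrite -linearP; congr (A _); apply: val_inj => /=.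
  by rewrite linearP /= scalerDr addrACA.
pose f : {linear _ -> _} := HB.pack (fun M : 'M[R]_n => A (add_tr M))
  (GRing.isLinear.Build _ _ _ _ _ flin).
have glin : linear (fun M : 'M[R]_n => M - M^T).
  by move=> a M N; rewrite linearP /= opprD addrACA scalerBr.
pose g : {linear _ -> _} := HB.pack (fun M : 'M[R]_n => M - M^T)
  (GRing.isLinear.Build _ _ _ _ _ glin).
pose h : {linear 'M[R]_n -> 'M[R]_n} := mulmx (Z : 'M[R]_n).
pose G := row_mx (lin_mx h) (row_mx (lin_mx f) (lin_mx g)).
have fS (W : 'S[R]_n) : add_tr W = 2 *: W.
  by apply: val_inj; rewrite /= sym_tr scaler_nat mulr2n.
have /row_freeP[K GK] : row_free G.
  rewrite -kermx_eq0; apply/rowV0P => u /sub_kermxP; rewrite -[u]vec_mxK.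
  set M := vec_mx u => /eqP; rewrite !mul_mx_row !mul_vec_lin !row_mx_eq0.
  case/and3P => /eqP ZM /eqP AM /eqP MM.
  have inj p q (V : 'M[R]_(p, q)) : mxvec V = 0 -> V = 0.
    by move=> V0; apply: (can_inj mxvecK); rewrite V0 linear0.
  have Msym : M \in @sym_pred R n.
    by rewrite unfold_in eq_sym -subr_eq0; apply/eqP/inj.
  suff /(congr1 (@mx_of_sym R n)) /= -> : SymMx Msym = 0 by rewrite linear0.
  apply: Ztr; last exact: inj ZM.
  have := inj _ _ _ AM; rewrite /f /= -[M]/(SymMx Msym : 'M[R]_n) fS linearZ => /eqP.
  by rewrite scaler_eq0 pnatr_eq0 /= => /eqP.
exists (mxdot K K) => [|W AW]; first exact: mxdot_ge0.
have -> : mxdot W W = mxdot (mxvec W) (mxvec W) by rewrite mxdot_mxvec.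
have -> : mxvec W = row_mx (mxvec ((Z : 'M[R]_n) *m W)) 0 *m K.
  rewrite -[LHS]mulmx1 -GK mulmxA; congr (_ *m _); rewrite !mul_mx_row !mul_vec_lin.
  rewrite /f /g /= sym_tr subrr fS linearZ /= AW scaler0 !linear0.
  by rewrite row_mx0.
apply: le_trans (mxdot_mul_le _ _) _; rewrite mulrC ler_wpM2l ?mxdot_ge0 //.
by rewrite /mxdot tr_row_mx mul_row_col trmx0 mulmx0 addr0 -/(mxdot _ _) mxdot_mxvec.
Qed.

Lemma transversal_growth (b : 'cV[R]_m) (C X : 'S[R]_n) :
    primal_transversal A X ->
    (forall y, dual_transversal A (C - adjoint A y)) ->
  primal_optimal A b C X -> quadratic_growth A b C X.
Proof.
move=> Xtr Ctr Xopt; have [[AX X0] _] := Xopt.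
have [lam [Z0 ZX]] := optimal_multiplier X0 (primal_transversal_onto Xtr) Xopt.
move=> Ls XE; split.
  exists lam; split=> //; set Z := (C - adjoint A lam : 'S[R]_n) in Z0 ZX *.
  have [k k0 kP] := psd_residual_bound Z0.
  apply: mxdot_eq0; apply: le_anti; rewrite mxdot_ge0 andbT.
  by rewrite (le_trans (kP _ _)) // -XE mxdot_sym ZX mxtrace0 mulr0.
have [k1 k10 k1P] := psd_residual_bound Z0.
have [k2 k20 k2P] := dual_transversal_bound (Ctr lam).
set Z := (C - adjoint A lam : 'S[R]_n) in Z0 ZX k1P k2P *.
(* Bounds [|L|^2] on the ball of radius 1 around [Ls]. *)
pose k3 := 2 * mxdot Ls Ls + 2.
have k30 : 0 < k3 by rewrite ltr_wpDl ?mulr_ge0 ?mxdot_ge0.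
pose k := k2 * k1 * k3 + 1.
have k0 : 0 < k by rewrite ltr_wpDl // !mulr_ge0 // ltW.
exists (2 / k), 1; split=> // [|L AL LLs]; first by rewrite divr_gt0.
set W := (gram L - X : 'S[R]_n).
have AW : A W = 0 by rewrite linearB AL AX subrr.
have L3 : mxdot L L <= k3.
  have : mxdot (L - Ls) (L - Ls) <= 1.
    rewrite -fnorm_sqr exprn_ile1 ?sqrtr_ge0 //; exact: ltW.
  have := mxdot_ge0 (L - 2 *: Ls).
  rewrite !mxdotBr !mxdotBl !mxdotZr !(mxdotC (_ *: _)) !mxdotZr (mxdotC L Ls) /k3.
  lra.
have CE (S : 'S[R]_n) : mxdot C S = mxdot Z S + mxdot lam (A S).
  by rewrite /= mxdotBl adjointP subrK.
have ZL : mxdot W W <= k * mxdot Z (gram L).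
  have ZW : (Z : 'M[R]_n) *m W = (Z : 'M[R]_n) *m L *m L^T.
    by rewrite mulmxBr ZX subr0 /= mulmxA.
  have gL : 0 <= mxdot Z (gram L) by exact: mxdot_psd_gram.
  apply: le_trans (k2P W AW) _; rewrite ZW.
  apply: le_trans (_ : k2 * (k1 * mxdot Z (gram L) * k3) <= _).
    rewrite ler_wpM2l // (le_trans (mxdot_mul_le _ _)) // mxdot_tr.
    by rewrite ler_pM ?mxdot_ge0.
  by rewrite /k; lra.
rewrite !CE AX AL (mxdot_sym Z X) ZX mxtrace0 add0r addrC lerD2r.
have -> : 2 / k / 2 = k^-1 by rewrite mulrAC mulfV ?mul1r ?pnatr_eq0.
by rewrite fnorm_sqr -/W mulrC ler_pdivrMr // mulrC.
Qed.

End Growth.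

Theorem proposition3 (R : realType) (n m : nat)
    (A : {linear 'S[R]_n -> 'cV[R]_m}) :
  generic (fun (b : 'cV[R]_m) (C : 'S[R]_n) =>
    [/\ forall X : 'S[R]_n, primal_feasible A b X -> primal_nondegenerate A X,
        forall y : 'cV[R]_m, dual_feasible A C y -> dual_nondegenerate A C y &
        forall X : 'S[R]_n, primal_optimal A b C X -> quadratic_growth A b C X]).
Proof.
have [N N0 NP] := generic_derivation (data_index m n) (adjoint_entries A).
apply: lebesgue_null_sub N0 => _ [[b C] /= bad <-]; apply: contrapT => Nd.
apply: bad; have D_ := NP _ Nd.
have Xtr X : A X = b -> primal_transversal A X.
  move=> AX y yX.
  have [D [DD Dcs Dx]] := D_ (fun i => if i is inl k then y k 0 else 0).
  apply: (primal_transversal_derivation DD Dcs AX _ yX).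
  by apply/matrixP => i j; rewrite mxE [j]ord1; exact: (Dx (inl i)).
have Ztr y : dual_transversal A (C - adjoint A y).
  move=> W AW ZW.
  have [D [DD Dcs Dx]] :=
    D_ (fun i => if i is inr p then W (val p).1 (val p).2 else 0).
  apply: (dual_transversal_derivation DD Dcs _ AW ZW).
  have up (i j : 'I_n) : (i <= j)%N -> D (C i j) = W i j.
    by move=> ij; exact: (Dx (inr (@exist _ (fun p : 'I_n * 'I_n => p.1 <= p.2)%N (i, j) ij))).
  apply/matrixP => i j; rewrite mxE; case: (leqP i j) => [/up //|/ltnW/up ji].
  by rewrite -(sym_tr C) -(sym_tr W) !mxE.
split=> [X [AX _]|y _|X Xopt].
- exact/primal_transversal_nondegenerate/Xtr.
- exact/dual_transversal_nondegenerate/Ztr.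
- by case: (Xopt) => -[/Xtr Xt _] _; exact: transversal_growth Xt Ztr Xopt.
Qed.
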